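(* Let $d,q\ge 1$ and let $b=(b_1,\dots,b_d)^T:\mathbb{R}^d\to\mathbb{R}^d$ and $\sigma=(\sigma_{ij}):\mathbb{R}^d\to\mathbb{R}^{d\times q}$ be $C^4$ functions for which there is a constant $K>0$ such that $|\partial_k\sigma_{ij}(x)|+|\partial_k b_i(x)|\le K$ for all $x\in\mathbb{R}^d$, $j=1,\dots,q$ and $i,k=1,\dots,d$. Put $a:=\sigma\sigma^T=(a_{ij})_{d\times d}$ and assume that there exists $\alpha>0$ such that $y^Ta(x)y\ge\alpha|y|^2$ for all $x,y\in\mathbb{R}^d$. Let $u\in C_c^\infty(\mathbb{R}^d)$. Then there exists a constant $C>0$, independent of $\tau$, such that for all $\tau>0$ $$\left\|\frac{\bar P_\tau u-u}{\tau}-Au\right\|_{L^1(\mathbb{R}^d)}\le C\tau.$$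
   Context: For $v\in C_c^\infty(\mathbb{R}^d)$, $$Av:=-\sum_{i=1}^d\partial_i(b_iv)+\frac12\sum_{i,j=1}^d\partial_i\partial_j(a_{ij}v).$$ For $\tau>0$, $\bar P_\tau$ is the one-step propagator of densities of the Euler-Maruyama scheme $X_{n+1}=X_n+b(X_n)\tau+\sigma(X_n)\Delta B$ (with $\Delta B$ an independent centered Gaussian increment of covariance $\tau I_q$), i.e. the operator on $L^1(\mathbb{R}^d)$ $$(\bar P_\tau v)(y)=\int_{\mathbb{R}^d}\bar k(y,x,\tau)v(x)\,dx,$$ $$\bar k(y,x,\tau)=\frac{\exp\left\{-\frac12\,(y-x-b(x)\tau)^T(\tau a(x))^{-1}(y-x-b(x)\tau)\right\}}{(2\pi)^{d/2}\,|\det(\tau a(x))|^{1/2}}.$$ *)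

(* Defs.v *)
From HB Require Import structures.
From mathcomp Require Import all_boot all_order all_algebra.
From mathcomp Require Import all_classical all_reals all_analysis.

Set Implicit Arguments.
Unset Strict Implicit.
Unset Printing Implicit Defensive.

Import Order.TTheory GRing.Theory Num.Theory.
Import numFieldNormedType.Exports.

Local Open Scope classical_set_scope.
Local Open Scope ring_scope.

(* Points of R^d are row vectors ['rV[R]_d]: a quadratic form y^T M y is
   written [(y *m M *m y^T) 0 0], and |y|^2 is [(y *m y^T) 0 0] because the
   library norm [`|y|] on matrices is the max norm. *)

Definition measure_rV_display : measure_display -> measure_display.
Proof. exact. Qed.

Section measurable_rV.
Context {d : measure_display} {T : sigmaRingType d}.
Variable n : nat.

Let coors : 'I_n -> 'rV[T]_n -> T := fun i x => x ord0 i.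

Let rV_set0 : g_sigma_preimage coors set0.
Proof. exact: sigma_algebra0. Qed.

Let rV_setC A : g_sigma_preimage coors A -> g_sigma_preimage coors (~` A).
Proof. exact: sigma_algebraC. Qed.

Let rV_bigcup (F : (set 'rV[T]_n)^nat) :
  (forall i, g_sigma_preimage coors (F i)) ->
  g_sigma_preimage coors (\bigcup_i (F i)).
Proof. exact: sigma_algebra_bigcup. Qed.

(* The product sigma-algebra, as the library does for [n.-tuple T]. *)
HB.instance Definition _ := @isMeasurable.Build (measure_rV_display d)
  'rV[T]_n (g_sigma_preimage coors) rV_set0 rV_setC rV_bigcup.

End measurable_rV.


Section measurable_rV_lemmas.
Context d1 d2 (T1 : measurableType d1) (T2 : measurableType d2).

Lemma measurable_coord n (i : 'I_n) :
  measurable_fun [set: 'rV[T2]_n] (fun x => x ord0 i).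
Proof.
move=> _ Y mY; rewrite setTI; apply: sub_sigma_algebra => /=.
rewrite -bigcup_seq/=; exists i => /=; first by rewrite mem_index_enum.
by exists Y => //; rewrite setTI.
Qed.

Lemma measurable_fun_rV n (f : T1 -> 'rV[T2]_n) :
  (forall i, measurable_fun setT (fun x => f x ord0 i)) ->
  measurable_fun [set: T1] f.
Proof.
move=> mf _ A mA; rewrite setTI.
have : (g_sigma_preimage (fun i => (fun x : 'rV[T2]_n => x ord0 i) \o f))
    (f @^-1` A).
  by rewrite g_sigma_preimage_comp; exists A => //; rewrite setTI.
move: (f @^-1` A); apply: smallest_sub; first exact: sigma_algebra_measurable.
move=> B; rewrite -bigcup_seq/= => -[i _ [C mC <-]].
exact: mf.
Qed.

End measurable_rV_lemmas.

Section lebesgue_rV.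
Variable R : realType.

Definition cons_rV n (p : R * 'rV[R]_n) : 'rV[R]_n.+1 :=
  row_mx (p.1)%:M p.2 : 'rV[R]_(1 + n).

Lemma cons_rV0 n (p : R * 'rV[R]_n) : cons_rV p ord0 ord0 = p.1.
Proof.
have -> : cons_rV p ord0 ord0 = row_mx (p.1)%:M p.2 ord0 (lshift n ord0).
  by congr (row_mx _ _ _ _); exact: val_inj.
by rewrite row_mxEl mxE eqxx mulr1n.
Qed.

Lemma cons_rVS n (p : R * 'rV[R]_n) i : cons_rV p ord0 (lift ord0 i) = p.2 ord0 i.
Proof.
have -> : cons_rV p ord0 (lift ord0 i) = row_mx (p.1)%:M p.2 ord0 (rshift 1 i).
  by congr (row_mx _ _ _ _); exact: val_inj.
by rewrite row_mxEr.
Qed.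

Lemma measurable_cons_rV n : measurable_fun setT (@cons_rV n).
Proof.
apply: measurable_fun_rV => i; have [j|] := unliftP ord0 i => ->.
  have -> : (fun p => @cons_rV n p ord0 (lift ord0 j)) =
      (fun v : 'rV[R]_n => v ord0 j) \o snd by apply/funext => p; rewrite cons_rVS.
  exact: (measurableT_comp (measurable_coord j) measurable_snd).
by rewrite (_ : (fun _ => _) = fst)//; apply/funext => p; rewrite cons_rV0.
Qed.

Section lebesgue_cons.
Variables (n : nat) (mu : {sigma_finite_measure set 'rV[R]_n -> \bar R}).

Definition lebesgue_cons : set 'rV[R]_n.+1 -> \bar R :=
  pushforward (lebesgue_measure \x mu)%E (@cons_rV n).




Let mcons : measurable_fun setT (@cons_rV n) := @measurable_cons_rV n.

Let lebesgue_cons0 : lebesgue_cons set0 = 0%E.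
Proof. exact: measure0. Qed.

Let lebesgue_cons_ge0 A : (0 <= lebesgue_cons A)%E.
Proof. exact: measure_ge0. Qed.

Let lebesgue_cons_sigma_additive : semi_sigma_additive lebesgue_cons.
Proof. exact: measure_semi_sigma_additive. Qed.

HB.instance Definition _ := isMeasure.Build _ _ _ lebesgue_cons
  lebesgue_cons0 lebesgue_cons_ge0 lebesgue_cons_sigma_additive.

Let lebesgue_cons_sigma_finite : sigma_finite setT lebesgue_cons.
Proof.
have /sigma_finiteP[F [FT ndF Foo]] := sigma_finiteT (@lebesgue_measure R).
have /sigma_finiteP[G [GT ndG Goo]] := sigma_finiteT mu.
pose g (x : 'rV[R]_n.+1) : R * 'rV[R]_n := (x ord0 ord0, \row_i x ord0 (lift ord0 i)).
have mg : measurable_fun setT g.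
  apply/measurable_fun_pairP; split; first exact: measurable_coord.
  apply: measurable_fun_rV => i /=.
  rewrite (_ : (fun _ => _) = fun x : 'rV[R]_n.+1 => x ord0 (lift ord0 i)).
    exact: measurable_coord.
  by apply/funext => x /=; rewrite mxE.
have gK : forall p, g (@cons_rV n p) = p.
  case=> a v; rewrite /g cons_rV0; congr pair.
  by apply/rowP => i; rewrite mxE cons_rVS.
exists (fun k => g @^-1` (F k `*` G k)).
  apply/esym; rewrite -subTset => x _.
  have [i _ Fi] : (\bigcup_i F i) (g x).1 by rewrite -FT.
  have [j _ Gj] : (\bigcup_j G j) (g x).2 by rewrite -GT.
  exists (maxn i j) => //; split.
  - by move: Fi; exact/subsetPset/ndF/leq_maxl.
  - by move: Gj; exact/subsetPset/ndG/leq_maxr.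
move=> k; have [mF Fk] := Foo k; have [mG Gk] := Goo k; split.
  by rewrite -[X in measurable X]setTI; apply: mg => //; exact: measurableX.
rewrite /lebesgue_cons /pushforward -comp_preimage (_ : g \o _ = id); last first.
  exact/funext.
by rewrite preimage_id product_measure1E// lte_mul_pinfty// ge0_fin_numE.
Qed.

HB.instance Definition _ := Measure_isSigmaFinite.Build _ _ _ lebesgue_cons
  lebesgue_cons_sigma_finite.

End lebesgue_cons.

Fixpoint lebesgue_rV n : {sigma_finite_measure set 'rV[R]_n -> \bar R} :=
  if n is k.+1 then lebesgue_cons (lebesgue_rV k) else dirac (0 : 'rV[R]_0).

Lemma lebesgue_rV_box n (A : 'I_n -> set R) :
  (forall i, measurable (A i)) ->
  (lebesgue_rV n [set x : 'rV[R]_n | forall i, A i (x ord0 i)] =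
   \prod_(i < n) lebesgue_measure (A i))%E.
Proof.
elim: n A => [|n IHn] A mA.
  by rewrite big_ord0 /= diracE mem_set//= => -[].
rewrite big_ord_recl -IHn//= /lebesgue_cons /pushforward.
rewrite -product_measure1E//.
  congr (product_measure1 _ _ _); apply/seteqP; split => [p /= Ap|p /= [Ap0 ApS] i].
    split; first by have := Ap ord0; rewrite cons_rV0.
    by move=> i; have := Ap (lift ord0 i); rewrite cons_rVS.
  by have [j|] := unliftP ord0 i => ->; rewrite ?cons_rVS ?cons_rV0.
  exact: mA.
have -> : [set x : 'rV[R]_n | forall i, A (lift ord0 i) (x ord0 i)] =
    \bigcap_(i in [set: 'I_n])
      ((fun x : 'rV[R]_n => x ord0 i) @^-1` A (lift ord0 i)).
  by apply/seteqP; split=> [x Ax i _|x Ax i]; exact: Ax.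
apply: fin_bigcap_measurable => // i _.
by rewrite -[X in measurable X]setTI; apply: measurable_coord.
Qed.

End lebesgue_rV.

Section statement_defs.
Variable R : realType.

Section derivatives.
Variable d : nat.

Definition partial (i : 'I_d) (f : 'rV[R]_d -> R) : 'rV[R]_d -> R :=
  'D_(delta_mx ord0 i) f.

(* [is_Ck k f]: all partial derivatives of [f] of order at most [k], iterated
   in any order, exist everywhere and are continuous. *)
Fixpoint is_Ck (k : nat) (f : 'rV[R]_d -> R) : Prop :=
  continuous f /\
  if k is k'.+1 then
    forall i : 'I_d, (forall x, derivable f x (delta_mx ord0 i)) /\
                     is_Ck k' (partial i f)
  else True.

Definition is_Ccinfty (f : 'rV[R]_d -> R) : Prop :=
  (forall k, is_Ck k f) /\ compact (closure [set x | f x != 0]).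

End derivatives.

Section euler_maruyama.
Variables d q : nat.
Variables (b : 'rV[R]_d -> 'rV[R]_d) (sigma : 'rV[R]_d -> 'M[R]_(d, q)).

Definition diffusion (x : 'rV[R]_d) : 'M[R]_d := sigma x *m (sigma x)^T.

Definition FP_operator (v : 'rV[R]_d -> R) (x : 'rV[R]_d) : R :=
  - (\sum_(i < d) partial i (fun z => b z ord0 i * v z) x) +
  2^-1 * \sum_(i < d) \sum_(j < d)
           partial i (partial j (fun z => diffusion z i j * v z)) x.

Definition EM_kernel (y x : 'rV[R]_d) (tau : R) : R :=
  let w := y - x - tau *: b x in
  let S := tau *: diffusion x in
  expR (- 2^-1 * (w *m invmx S *m w^T) ord0 ord0) /
  ((2 * pi) `^ (d%:R / 2) * Num.sqrt `|\det S|).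

Definition EM_propagator (tau : R) (v : 'rV[R]_d -> R) (y : 'rV[R]_d) : R :=
  \int[lebesgue_rV R d]_x (EM_kernel y x tau * v x).

End euler_maruyama.

End statement_defs.

(* Main.v *)
Require Import Defs.
From mathcomp Require Import all_boot all_order all_algebra.
From mathcomp Require Import all_classical all_reals all_analysis.
From mathcomp Require Import measurable_realfun lebesgue_integral_under ring lra.
Import Order.TTheory GRing.Theory Num.Theory.
Import numFieldNormedType.Exports.

Local Open Scope classical_set_scope.
Local Open Scope ring_scope.

Set Implicit Arguments.
Unset Strict Implicit.
Unset Printing Implicit Defensive.

(** Write [s] for the square root of the time step [tau], [a] for the diffusion matrix and
    [p] for its inverse.  The substitution [x = y - s z] in the definition of the propagator
    gives
      [(EM_propagator u) y = \int H (y - s z, s, z) dz],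
      [H (x, s, z) = u x * g (x, z - s * b x)],
    where [g (x, .)] is the centred Gaussian density of covariance [a x]
    ([EM_propagator_density]).  The singular limit of small [tau] has disappeared: the
    integrand is of class C^4 in [s], and its derivatives are polynomials in [z], with
    coefficients supported in the support of [u], times a Gaussian.

    The function [H] is invariant under [(s, z) |-> (- s, - z)], so the integral is even in
    [s] and only the terms of order 0 and 2 of its Taylor expansion survive, with a
    remainder of order [s^4 = tau^2] ([symmetric_taylor4]).  The term of order 0 is the
    mass of a Gaussian and gives [u y].  The term of order 2 is half the integral of
      [H_ss - 2 \sum_i z_i H_si + \sum_(i, j) z_i z_j H_ij]
    at [(y, 0, z)].  Differentiating under the integral sign the moments
      [\int H dz = u], [\int z_i H dz = s b_i u], [\int z_i z_j H dz = a_ij u] at [s = 0],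
    one finds that this is the Fokker-Planck operator applied to [u] ([integ_flow2]).

    The remainder is controlled pointwise in [y] by [C s^4 exp (- e |y|^2)]
    ([density_expansion]): it is Gaussian in [z], and since [y - r z] must lie in the
    support of [u] for some [|r| <= 1], a large [y] forces a large [z].  Integrating in [y]
    proves the claim for [tau <= 1].  For [tau > 1] the propagator contracts the L^1 norm
    ([le_norm1_EM_propagator]), so the quantity to be estimated is bounded, hence at most
    a multiple of [tau] ([le_norm1_of_expansion]).

    The facts about Gaussians come from [gauss_integral_rV], proved by completing the
    square one coordinate at a time.  The regularity and decay of [H] and its derivatives
    are packaged in the predicate [gaussian_class]. *)

(** * Measurability and iterated integrals on row vectors *)
Section lebesgue_rV_theory.
Context {R : realType}.
Implicit Types n : nat.

(** The measure in dimension [n.+1] is the image of a product measure, so Tonelli's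
    theorem splits off the first coordinate; this is the induction step for every
    computation of an integral below. *)
Lemma ge0_integral_cons_rV n (f : 'rV[R]_n.+1 -> \bar R) :
  measurable_fun setT f -> (forall x, 0 <= f x)%E ->
  (\int[lebesgue_rV R n.+1]_x f x =
   \int[lebesgue_rV R n]_v \int[lebesgue_measure]_t f (cons_rV (t, v)))%E.
Proof.
move=> mf f0.
rewrite [lebesgue_rV R n.+1]/= (_ : Measure.sort _ = pushforward
  (lebesgue_measure \x lebesgue_rV R n)%E (@cons_rV R n))//.
rewrite ge0_integral_pushforward//=; last exact: measurable_cons_rV.
rewrite preimage_setT; apply: fubini_tonelli2 => [|p]; last exact: f0.
by apply: measurableT_comp => //; exact: measurable_cons_rV.
Qed.

Lemma mx_norm_lt n (x : 'rV[R]_n) (e : R) : 0 < e ->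
  (`|x| < e) <-> forall i, `|x ord0 i| < e.
Proof.
move=> e0; split=> [xe i|xe].
  apply: le_lt_trans xe; rewrite (_ : `|x| = mx_norm x)// mx_normrE.
  by apply: (le_bigmax _ (fun i => `|x i.1 i.2|) (ord0, i)).
rewrite (_ : `|x| = mx_norm x)// mx_normrE; apply: bigmax_lt => // -[i j] _ /=.
by rewrite (ord1 i).
Qed.

Lemma mx_norm_le n (x : 'rV[R]_n) (e : R) : 0 <= e ->
  (`|x| <= e) <-> forall i, `|x ord0 i| <= e.
Proof.
move=> e0; split=> [xe i|xe].
  apply: le_trans xe; rewrite (_ : `|x| = mx_norm x)// mx_normrE.
  by apply: (le_bigmax _ (fun i => `|x i.1 i.2|) (ord0, i)).
rewrite (_ : `|x| = mx_norm x)// mx_normrE; apply: bigmax_le => // -[i j] _ /=.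
by rewrite (ord1 i).
Qed.

(** The sigma-algebra on row vectors is generated by the coordinates and not by the
    topology.  An open set is nevertheless a countable union of cubes with rational
    centres, and cubes are measurable. *)
Lemma continuous_measurable_rV n (f : 'rV[R]_n -> R) :
  continuous f -> measurable_fun setT f.
Proof.
move=> cf; apply: (measurability _ (@RGenOpens.measurableE R)).
move=> _ [_ [a [b -> <-]]]; rewrite setTI.
set O := f @^-1` _.
have oO : open O by apply: open_comp => [x _|]; [exact: cf|exact: interval_open].
(* cubes are indexed by a rational centre and the inverse of an integer as radius *)
pose c (p : 'rV[rat]_n * nat) : 'rV[R]_n := map_mx ratr p.1.
pose D := [set p : 'rV[rat]_n * nat | ball (c p) (p.2.+1%:R^-1) `<=` O].
have -> : O = \bigcup_(p in D) ball (c p) (p.2.+1%:R^-1).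
  apply/seteqP; split => [x Ox|x [p Dp]]; last exact: Dp.
  have /nbhs_ballP[e/= e0 xeO] : nbhs x O by exact: open_nbhs_nbhs.
  have e20 : 0 < e / 2 by rewrite divr_gt0.
  have [k] := ltr_add_invr e20.
  rewrite add0r; set dk := k.+1%:R^-1 => ke.
  have k0 : 0 < dk by rewrite invr_gt0.
  have /choice[r rP] : forall i, exists r : rat, `|x ord0 i - ratr r| < dk.
    move=> i; have /rat_in_itvoo[r] : x ord0 i - dk < x ord0 i + dk by lra.
    rewrite in_itv/= => /andP[h1 h2]; exists r; by rewrite ltr_norml; apply/andP; split; lra.
  have xr : ball (c (\row_i r i, k)) (dk) x.
    rewrite mx_norm_ball /ball_/=; apply/mx_norm_lt => // i.
    by rewrite !mxE distrC.
  exists (\row_i r i, k) => //= y; move/ball_sym: xr => xr ry.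
  have dke : dk + dk <= e by lra.
  by apply: xeO; apply: le_ball (ball_triangle xr ry).
rewrite bigcup_mkcond; apply: countable_bigcupT_measurable => [|p].
  exact: countableP.
case: ifP => // _.
have -> : ball (c p) (p.2.+1%:R^-1) = \bigcap_(i in [set: 'I_n])
    ((fun x : 'rV[R]_n => x ord0 i) @^-1` ball (c p ord0 i) (p.2.+1%:R^-1)).
  apply/seteqP; rewrite mx_norm_ball; split=> [x /mx_norm_lt h i _|x h].
    by have := h ltac:(by rewrite invr_gt0) i; rewrite !mxE.
  by apply/mx_norm_lt; rewrite ?invr_gt0// => i; have := h i Logic.I; rewrite !mxE.
apply: fin_bigcap_measurable => // i _.
rewrite -[X in measurable X]setTI; apply: measurable_coord => //.
exact: measurable_ball.
Qed.

End lebesgue_rV_theory.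

(** * Affine changes of variables for Lebesgue measure *)
Section affine_change_of_variables.
Context {R : realType}.
Implicit Types n : nat.

(** Both sides are measures that agree on half-open intervals; the sign of [c] only
    decides which end of the preimage interval is closed. *)
Lemma lebesgue_measure_affine (a c : R) : c != 0 ->
  forall A, measurable A ->
  (lebesgue_measure A = `|c|%:E *
    pushforward lebesgue_measure
      ((fun t => a + c * t)%R : measurableTypeR R -> measurableTypeR R) A)%E.
Proof.
move=> c0.
have mphi : measurable_fun setT
    ((fun t => a + c * t)%R : measurableTypeR R -> measurableTypeR R).
  by apply: measurable_funD => //; exact: measurable_funM.
pose P : {measure set (measurableTypeR R) -> \bar R} :=
  measure_function_pushforward__canonical__measure_function_Measure
    lebesgue_measure mphi.
pose M : {measure set (measurableTypeR R) -> \bar R} := mscale (NngNum (normr_ge0 c)) P.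
move=> A mA.
suff : forall X, ocitv X -> lebesgue_measure X = M X.
  by move=> /lebesgue_measure_unique; exact.
move=> _ [[x y] _ <-]; rewrite /M /P /= /mscale/= /pushforward.
have [cn|cp] := ltP c 0.
  have -> : (fun t => a + c * t) @^-1` `]x, y] = `[(y - a) / c, (x - a) / c[%classic.
    apply/seteqP; split=> t /=; rewrite !in_itv/= ler_ndivrMr// ltr_ndivlMr// => /andP[h1 h2].
      by apply/andP; split; lra.
    by apply/andP; split; lra.
  rewrite !lebesgue_measure_itv/= !lte_fin ltr_ndivrMr// divfK// ltrD2r.
  case: ifP => _; last by rewrite mule0.
  rewrite -!EFinB -EFinM ltr0_norm//; congr EFin.
  by field; rewrite c0.
have {}cp : 0 < c by rewrite lt0r c0.
have -> : (fun t => a + c * t) @^-1` `]x, y] = `](x - a) / c, (y - a) / c]%classic.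
  apply/seteqP; split=> t /=; rewrite !in_itv/= ler_pdivlMr// ltr_pdivrMr// => /andP[h1 h2].
    by apply/andP; split; lra.
  by apply/andP; split; lra.
rewrite !lebesgue_measure_itv/= !lte_fin ltr_pdivrMr// divfK// ltrD2r.
case: ifP => _; last by rewrite mule0.
rewrite -!EFinB -EFinM gtr0_norm//; congr EFin.
by field; rewrite c0.
Qed.

Lemma ge0_integral_affineR (a c : R) (f : R -> \bar R) : c != 0 ->
  measurable_fun setT f -> (forall x, 0 <= f x)%E ->
  (\int[lebesgue_measure]_t f (a + c * t)%R =
   (`|c|^-1)%:E * \int[lebesgue_measure]_t f t)%E.
Proof.
move=> c0 mf f0.
have mphi : measurable_fun setT
    ((fun t => a + c * t)%R : measurableTypeR R -> measurableTypeR R).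
  by apply: measurable_funD => //; exact: measurable_funM.
pose P : {measure set (measurableTypeR R) -> \bar R} :=
  measure_function_pushforward__canonical__measure_function_Measure
    lebesgue_measure mphi.
pose M : {measure set (measurableTypeR R) -> \bar R} := mscale (NngNum (normr_ge0 c)) P.
rewrite [in RHS](eq_measure_integral M) => [|A mA _]; last first.
  exact: lebesgue_measure_affine.
rewrite ge0_integral_mscale//= muleA -EFinM mulVf ?normr_eq0// mul1e.
by rewrite ge0_integral_pushforward.
Qed.

Lemma measurable_affine_rV n (y : 'rV[R]_n) (c : R) :
  measurable_fun setT (fun z : 'rV[R]_n => y + c *: z).
Proof.
apply: measurable_fun_rV => i.
rewrite (_ : (fun _ => _) = fun z : 'rV[R]_n => y ord0 i + c * z ord0 i).
  by apply: measurable_funD => //; apply: measurable_funM => //; exact: measurable_coord.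
by apply/funext => z; rewrite !mxE.
Qed.

(** Induction on the dimension: the first coordinate is substituted by the
    one-dimensional formula, the others by the induction hypothesis. *)
Lemma ge0_integral_affine n (y : 'rV[R]_n) (c : R) (f : 'rV[R]_n -> \bar R) :
  c != 0 -> measurable_fun setT f -> (forall x, 0 <= f x)%E ->
  (\int[lebesgue_rV R n]_z f (y + c *: z)%R =
   (`|c| ^- n)%:E * \int[lebesgue_rV R n]_z f z)%E.
Proof.
move=> c0; elim: n y f => [|n IH] y f mf f0.
  rewrite expr0 invr1 mul1e; apply: eq_integral => z _.
  by rewrite (thinmx0 (y + _)) (thinmx0 z).
have mcons v : measurable_fun setT (fun t => f (cons_rV (t, v))).
  apply: measurableT_comp => //; apply: measurableT_comp => //.
  exact: measurable_cons_rV.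
rewrite !ge0_integral_cons_rV//; last first.
  by apply: measurableT_comp => //; exact: measurable_affine_rV.
pose y' := \row_i y ord0 (lift ord0 i).
have E t v : y + c *: cons_rV (t, v) = cons_rV (y ord0 ord0 + c * t, y' + c *: v).
  have aE m (a b : 'rV[R]_m) i : (a + c *: b) ord0 i = a ord0 i + c * b ord0 i.
    by rewrite !mxE.
  apply/rowP => i; rewrite aE; have [j|] := unliftP ord0 i => ->.
    by rewrite !cons_rVS/= aE mxE.
  by rewrite !cons_rV0.
under eq_integral => v _.
  under eq_integral => t _ do rewrite E.
  rewrite (ge0_integral_affineR (y ord0 ord0)
    (f := fun t => f (cons_rV (t, y' + c *: v))))//.
  over.
have mI : measurable_fun setT
    (fun v => \int[lebesgue_measure]_t f (cons_rV (t, v)))%E.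
  have := @measurable_fun_fubini_tonelli_G _ _ _ _ R lebesgue_measure
    (fun p => f (@cons_rV R n p)).
  apply => //; apply: measurableT_comp => //; exact: measurable_cons_rV.
have I0 v : (0 <= \int[lebesgue_measure]_t f (cons_rV (t, v)))%E.
  exact: integral_ge0.
rewrite (@ge0_integralZl _ _ _ (lebesgue_rV R n) setT measurableT _
  (measurableT_comp mI (measurable_affine_rV y' c)) _ (fun v _ => I0 _)); last first.
  by rewrite lee_fin invr_ge0.
rewrite (IH y' (fun v => \int[lebesgue_measure]_t f (cons_rV (t, v)))%E)//.
by rewrite muleA -EFinM exprS invfM.
Qed.

(** The Jacobian stands inside the left integral, so that the positive and the negative
    part are substituted separately and no scalar is factored out of a difference of
    infinities. *)
Lemma Rintegral_affine n (y : 'rV[R]_n) (c : R) (f : 'rV[R]_n -> R) :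
  c != 0 -> measurable_fun setT f ->
  \int[lebesgue_rV R n]_z (`|c| ^+ n * f (y + c *: z)) =
  \int[lebesgue_rV R n]_z f z.
Proof.
move=> c0 mf; congr fine.
have k0 : 0 <= `|c| ^+ n by [].
have kE (g : 'rV[R]_n -> \bar R) : measurable_fun setT g -> (forall x, 0 <= g x)%E ->
    (\int[lebesgue_rV R n]_z ((`|c| ^+ n)%:E * g (y + c *: z)%R) =
     \int[lebesgue_rV R n]_z g z)%E.
  move=> mg g0; rewrite ge0_integralZl//; last first.
    exact: (measurableT_comp mg (measurable_affine_rV y c)).
  rewrite ge0_integral_affine// muleA -EFinM divff ?mul1e//.
  by rewrite expf_neq0// normr_eq0.
have mF : measurable_fun setT (EFin \o f) by exact/measurable_EFinP.
rewrite [LHS]integralE [RHS]integralE; congr (_ - _)%E.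
  rewrite -[RHS]kE//; last exact: measurable_funepos.
  apply: eq_integral => z _; rewrite !funeposE/= EFinM.
  by rewrite maxe_pMr// mule0.
rewrite -[RHS]kE//; last exact: measurable_funeneg.
apply: eq_integral => z _; rewrite !funenegE/= -mulrN EFinM.
by rewrite maxe_pMr// mule0.
Qed.

End affine_change_of_variables.

(** * Quadratic forms and the Gaussian integral *)
Section gaussian_integral.
Context {R : realType}.
Implicit Types n : nat.

Definition quadf n (M : 'M[R]_n) (z : 'rV[R]_n) : R := (z *m M *m z^T) ord0 ord0.

Lemma quadfE n (M : 'M[R]_n) z :
  quadf M z = \sum_i \sum_j M i j * (z ord0 i * z ord0 j).
Proof.
rewrite /quadf mxE exchange_big/=; apply: eq_bigr => j _.
by rewrite !mxE mulr_suml; apply: eq_bigr => i _; ring.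
Qed.

Lemma measurable_quadf n (M : 'M[R]_n) : measurable_fun setT (quadf M).
Proof.
rewrite (_ : quadf M = fun z => \sum_i \sum_j M i j * (z ord0 i * z ord0 j)).
  apply: measurable_sum => i; apply: measurable_sum => j.
  by apply: measurable_funM => //; apply: measurable_funM; exact: measurable_coord.
by apply/funext => z; rewrite quadfE.
Qed.

Lemma quadfN n (M : 'M[R]_n) z : quadf M (- z) = quadf M z.
Proof. by rewrite /quadf linearN/= mulNmx mulmxN mulNmx opprK. Qed.

Lemma quadfZ n (M : 'M[R]_n) (s : R) z : quadf M (s *: z) = s ^+ 2 * quadf M z.
Proof.
rewrite /quadf linearZ/= -scalemxAl -scalemxAl -scalemxAr scalerA mxE; congr (_ * _).
Qed.

(** When [w] is the [j]-th row of the inverse of [M], the cross term of the quadratic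
    form is just the coordinate [z_j].  This makes the shift by [t *: w] the right
    perturbation for extracting second moments. *)
Lemma quadf_shift n (M : 'M[R]_n) (z w : 'rV[R]_n) (t : R) j : M^T = M ->
  w *m M = delta_mx ord0 j ->
  quadf M (z - t *: w) = quadf M z - 2 * t * z ord0 j + t ^+ 2 * w ord0 j.
Proof.
move=> symM wM.
have aE (a b : 'M[R]_1) : (a + b) ord0 ord0 = a ord0 ord0 + b ord0 ord0 by rewrite mxE.
have oE (a : 'M[R]_1) : (- a) ord0 ord0 = - a ord0 ord0 by rewrite mxE.
have zE c (a : 'M[R]_1) : (c *: a) ord0 ord0 = c * a ord0 ord0 by rewrite mxE.
have h1 (v : 'rV[R]_n) : (w *m M *m v^T) ord0 ord0 = v ord0 j.
  by rewrite wM -rowE !mxE.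
have h2 (v : 'rV[R]_n) : (v *m M *m w^T) ord0 ord0 = v ord0 j.
  have -> : v *m M *m w^T = (w *m M *m v^T)^T by rewrite !trmx_mul trmxK symM mulmxA.
  by rewrite mxE h1.
rewrite /quadf mulmxBl linearB/= mulmxBr !mulmxBl linearZ/=.
rewrite -!scalemxAl -!scalemxAr -?scalemxAl !(aE, oE, zE) !h1 h2.
by ring.
Qed.

(** The normal density of mean [- h] and variance [m^-1], freed of its normalisation. *)
Lemma gauss_integralR (m h : R) : 0 < m ->
  (\int[lebesgue_measure]_t (expR (- 2^-1 * (m * (t + h) ^+ 2)))%:E =
   (Num.sqrt (2 * pi) / Num.sqrt m)%:E)%E.
Proof.
move=> m0.
have s0 : (Num.sqrt m)^-1 != 0 by rewrite invr_eq0 gt_eqF// sqrtr_gt0.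
pose c := Num.sqrt (2 * pi) / Num.sqrt m.
transitivity (\int[lebesgue_measure]_t (c%:E * (normal_pdf (- h) (Num.sqrt m)^-1 t)%:E))%E.
  apply: eq_integral => t _; rewrite -EFinM; congr EFin.
  rewrite normal_pdfE// /normal_peak /normal_fun.
  rewrite exprVn sqr_sqrtr ?ltW// mulrA.
  have -> : Num.sqrt (m^-1 * pi *+ 2) = c.
    rewrite /c -sqrtrV ?ltW// -sqrtrM ?mulr_ge0 ?pi_ge0//.
    by congr Num.sqrt; rewrite -mulr_natl; ring.
  rewrite [RHS]mulrA divff ?mul1r; last first.
    by rewrite mulf_neq0// gt_eqF// sqrtr_gt0 mulr_gt0// pi_gt0.
  congr expR; rewrite opprK -mulr_natl; field.
  by rewrite gt_eqF.
rewrite ge0_integralZl//; last 3 first.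
- by apply/measurable_EFinP; exact: measurable_normal_pdf.
- by move=> t _; rewrite lee_fin normal_pdf_ge0.
- by rewrite lee_fin divr_ge0.
by rewrite integral_normal_pdf mule1.
Qed.

(** Induction on the dimension by completing the square: with [m] the corner of [M] and
    [v] the rest of its first row, the form splits as [m (t + v.w / m)^2 + w S w^T], where [S]
    is the Schur complement of [m].  Then [S] is again symmetric positive definite and
    [\det M = m * \det S]. *)
Lemma gauss_integral_rV n (M : 'M[R]_n) : M^T = M ->
  (forall z, z != 0 -> 0 < quadf M z) ->
  0 < \det M /\
  (\int[lebesgue_rV R n]_z (expR (- 2^-1 * quadf M z))%:E =
   (Num.sqrt (2 * pi) ^+ n / Num.sqrt (\det M))%:E)%E.
Proof.
elim: n M => [|n IH] M symM pdM.
  rewrite det_mx00 ltr01 sqrtr1 divr1 expr0; split => //.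
  under eq_integral do rewrite quadfE big_ord0 mulr0 expR0.
  by rewrite integral_cst//= diracT mule1.
have symE i j : M i j = M j i by rewrite -{1}symM mxE.
pose M' : 'M[R]_(1 + n) := M.
pose m := M ord0 ord0; pose v : 'rV[R]_n := ursubmx M'.
pose S := drsubmx M' - m^-1 *: (v^T *m v).
have ME : M' = block_mx m%:M v v^T (drsubmx M').
  rewrite -[LHS]submxK; congr block_mx; apply/matrixP => i j.
    by rewrite !ord1 !mxE eqxx mulr1n; congr (M _ _); exact: val_inj.
  by rewrite !mxE symE.
have m0 : 0 < m.
  have := pdM (delta_mx ord0 ord0); rewrite /quadf -rowE trmx_delta -colE !mxE.
  apply; apply/eqP => /matrixP/(_ ord0 ord0); rewrite !mxE !eqxx.
  by move/eqP; rewrite oner_eq0.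
have mn0 : m != 0 by rewrite gt_eqF.
have qE t w : quadf M (cons_rV (t, w)) =
    m * (t + m^-1 * (w *m v^T) ord0 ord0) ^+ 2 + quadf S w.
  have vwE : (v *m w^T) ord0 ord0 = (w *m v^T) ord0 ord0.
    by rewrite -[v *m _]trmxK trmx_mul trmxK mxE.
  have sE (a b : 'M[R]_1) : (a *m b) ord0 ord0 = a ord0 ord0 * b ord0 ord0.
    by rewrite mxE big_ord1.
  have -> : quadf M (cons_rV (t, w)) =
      (row_mx t%:M w *m M' *m (row_mx t%:M w)^T) ord0 ord0 by [].
  rewrite ME mul_row_block tr_row_mx mul_row_col /quadf /S.
  rewrite mulmxBr mulmxBl -scalemxAr -scalemxAl !mulmxDl.
  rewrite (mulmxA w) -(mulmxA (w *m v^T) v) tr_scalar_mx.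
  rewrite -!(mulmxA t%:M) !mul_scalar_mx scale_scalar_mx mul_mx_scalar.
  have aE (a b : 'M[R]_1) : (a + b) ord0 ord0 = a ord0 ord0 + b ord0 ord0.
    by rewrite mxE.
  have zE c (a : 'M[R]_1) : (c *: a) ord0 ord0 = c * a ord0 ord0 by rewrite mxE.
  have oE (a : 'M[R]_1) : (- a) ord0 ord0 = - a ord0 ord0 by rewrite mxE.
  have cE (c : R) : (c%:M : 'M[R]_1) ord0 ord0 = c by rewrite mxE mulr1n.
  by rewrite !aE oE !zE sE vwE cE; field.
have symS : S^T = S.
  rewrite /S linearB/= linearZ/= trmx_mul trmxK; congr (_ - _).
  by apply/matrixP => i j; rewrite !mxE symE.
have pdS w : w != 0 -> 0 < quadf S w.
  (* the first coordinate that minimises the form for a given [w] *)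
  move=> w0; have := pdM (cons_rV (- (m^-1 * (w *m v^T) ord0 ord0), w)).
  rewrite qE addNr expr0n mulr0 add0r; apply.
  apply: contraNneq w0 => /rowP h; apply/eqP/rowP => i.
  by have := h (lift ord0 i); rewrite cons_rVS !mxE.
have detM : \det M = m * \det S.
  have -> : \det M = \det M' by [].
  (* elimination of the first column *)
  have -> : M' = block_mx 1%:M 0 (m^-1 *: v^T) 1%:M *m block_mx m%:M v 0 S.
    rewrite mulmx_block !mul1mx !mul0mx !addr0 ME -scalemxAl mul_mx_scalar scalerA.
    by rewrite mulVf// scale1r /S -scalemxAl addrC subrK.
  by rewrite det_mulmx det_lblock det_ublock !det1 !mul1r det_scalar1.
have [dS IS] := IH _ symS pdS.
rewrite detM; split; first exact: mulr_gt0.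
rewrite ge0_integral_cons_rV//; last first.
  apply/measurable_EFinP; apply: measurableT_comp => //.
  by apply: measurable_funM => //; exact: measurable_quadf.
under eq_integral => w _.
  under eq_integral => t _ do rewrite qE mulrDr expRD EFinM.
  rewrite ge0_integralZr//; last first.
    apply/measurable_EFinP; apply: measurableT_comp => //.
    apply: measurable_funM => //; apply: measurable_funM => //.
    by apply: measurable_funX; exact: measurable_funD.
  rewrite gauss_integralR//.
  over.
rewrite ge0_integralZl//; last first.
  apply/measurable_EFinP; apply: measurableT_comp => //.
  by apply: measurable_funM => //; exact: measurable_quadf.
rewrite IS -EFinM (sqrtrM (\det S) (ltW m0)) exprS invfM; congr EFin.
by ring.
Qed.

End gaussian_integral.

(** * Derivatives along lines *)
Section first_order_expansion.
Context {R : realType}.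

Lemma is_derive_unique (V : normedModType R) (f : V -> R) (x v : V) (k l : R) :
  is_derive x v f k -> is_derive x v f l -> k = l.
Proof. by move=> [_ <-] [_ <-]. Qed.

(** The epsilon form of differentiability; it lets derivatives be transported between
    functions that agree up to a translation of the variable. *)
Lemma is_derive_expansion (g : R -> R) (t l : R) :
  is_derive t 1 g l <->
  forall e, 0 < e -> exists2 del, 0 < del &
    forall h, `|h| < del -> `|g (t + h) - g t - h * l| <= e * `|h|.
Proof.
split=> [[dg <-] e e0|H].
  have /cvgrPdist_le/(_ e e0) : h^-1 *: (g (h *: 1 + t) - g t) @[h --> 0^'] --> 'D_1 g t.
    exact: dg.
  rewrite near_withinE => /nbhs_ballP[del/= del0 H]; exists del => // h hdel.
  have [->|h0] := eqVneq h 0; first by rewrite addr0 subrr mul0r subrr normr0 mulr0.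
  have := H h; rewrite /ball/= sub0r normrN => /(_ hdel h0).
  rewrite /GRing.scale/= mulr1 [h + t]addrC => {}H.
  have -> : g (t + h) - g t - h * 'D_1 g t =
     - (h * ('D_1 g t - h^-1 * (g (t + h) - g t))) by field.
  by rewrite normrN normrM mulrC ler_wpM2r.
have cv : h^-1 *: (g (h *: 1 + t) - g t) @[h --> 0^'] --> l.
  apply/cvgrPdist_le => e e0; have [del del0 {}H] := H e e0.
  rewrite near_withinE; apply/nbhs_ballP; exists del => //= h.
  rewrite /ball/= sub0r normrN => /H{}H h0.
  have hp : 0 < `|h| by rewrite normr_gt0.
  rewrite -(ler_pM2l hp) -normrM mulrC [`|h| * e]mulrC -normrN.
  have -> : - ((l - h^-1 *: (g (h *: 1 + t) - g t)) * h) =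
    g (t + h) - g t - h * l.
    by rewrite /GRing.scale/= mulr1 [h + t]addrC; field.
  exact: H.
split; first by apply/cvg_ex; exists l.
exact: cvg_lim cv.
Qed.

Lemma derive_mvt_le (g dg : R -> R) (a b : R) (c M : R) :
  (forall t : R, is_derive t 1 g (dg t)) ->
  (forall t, `|t - a| <= `|b - a| -> `|dg t - c| <= M) ->
  `|g b - g a - (b - a) * c| <= M * `|b - a|.
Proof.
move=> gd dgM.
have gc : continuous g.
  by move=> t; apply: differentiable_continuous; apply/derivable1_diffP; case: (gd t).
have [ab|ba] := leP a b.
  have [x xab ->] := MVT_segment ab (fun t _ => gd t) (continuous_subspaceT gc).
  move: xab; rewrite in_itv/= => /andP[ax xb].
  rewrite mulrC -mulrBr normrM mulrC ler_wpM2r// dgM//.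
  by rewrite !ger0_norm ?subr_ge0// lerD2r.
have [x xab E] := MVT_segment (ltW ba) (fun t _ => gd t) (continuous_subspaceT gc).
move: xab; rewrite in_itv/= => /andP[bx xa].
have -> : g b - g a - (b - a) * c = (b - a) * (dg x - c) by rewrite -[g b - g a]opprB E; ring.
rewrite normrM mulrC ler_wpM2r// dgM//.
rewrite (ler0_norm (x := x - a)) ?subr_le0// ler0_norm ?subr_le0 ?(ltW ba)//; lra.
Qed.

Lemma derive_le (g dg : R -> R) (s M : R) :
  (forall t : R, is_derive t 1 g (dg t)) -> g 0 = 0 ->
  (forall t, `|t| <= s -> `|dg t| <= M) ->
  forall t, `|t| <= s -> `|g t| <= M * s.
Proof.
move=> gd g0 dgM t ts.
have M0 : 0 <= M by apply: le_trans (dgM t ts).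
have := @derive_mvt_le g dg 0 t 0 M gd.
rewrite g0 !subr0 mulr0 subr0 => H.
apply: le_trans (H _) _; last by rewrite ler_wpM2l.
by move=> r; rewrite !subr0 => rt; apply: dgM; apply: le_trans ts.
Qed.

(** A directional derivative is the derivative of the restriction to a line, which
    gives access to the calculus of functions of one real variable. *)
Lemma is_derive_line (V : normedModType R) (f : V -> R) (x v : V) (t l : R) :
  is_derive (x + t *: v) v f l <-> is_derive t 1 (fun r : R => f (x + r *: v)) l.
Proof.
have E : (fun h : R => h^-1 *: ((f \o shift (x + t *: v)) (h *: v) - f (x + t *: v))) =
    (fun h : R => h^-1 *: (((fun r : R => f (x + r *: v)) \o shift t) (h *: 1) - f (x + t *: v))).
  apply/funext => h /=; congr (_ *: (f _ - _)).
  by rewrite [_%:A]mulr1 scalerDl addrCA.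
by split=> -[dx vx]; split; move: dx vx; rewrite /derivable /derive E.
Qed.

Lemma is_derive_at0 (V : normedModType R) (f : V -> R) (x v : V) (l : R) :
  is_derive x v f l <-> is_derive (0 : R) 1 (fun r : R => f (x + r *: v)) l.
Proof. by rewrite -is_derive_line scale0r addr0. Qed.

End first_order_expansion.

(** * Functions of class C^k *)
Section Ck.
Context {R : realType} (d : nat).
Implicit Types (f g : 'rV[R]_d -> R) (k : nat).

Lemma is_Ck_continuous k f : is_Ck k f -> continuous f.
Proof. by case: k => [|k] []. Qed.

Lemma is_CkS k f : is_Ck k.+1 f -> is_Ck k f.
Proof.
elim: k f => [|k IH] f /= [cf df]; split => // i.
by have [dfi /IH] := df i; split.
Qed.

Lemma partialD f g i : (forall x, derivable f x (delta_mx ord0 i)) ->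
  (forall x, derivable g x (delta_mx ord0 i)) ->
  partial i (f \+ g) = partial i f \+ partial i g.
Proof. by move=> df dg; apply/funext => x; rewrite /partial deriveD. Qed.

Lemma partialM f g i : (forall x, derivable f x (delta_mx ord0 i)) ->
  (forall x, derivable g x (delta_mx ord0 i)) ->
  partial i (f \* g) = (f \* partial i g) \+ (g \* partial i f).
Proof. by move=> df dg; apply/funext => x; rewrite /partial deriveM. Qed.

Lemma partial_cst (c : R) i : partial i (fun _ : 'rV[R]_d => c) = (fun=> 0).
Proof. by apply/funext => x; rewrite /partial derive_cst. Qed.

Lemma is_Ck_cst k (c : R) : is_Ck k (fun _ : 'rV[R]_d => c).
Proof.
elim: k c => [|k IH] c; (split; first exact: cst_continuous) => //.
by move=> i; rewrite partial_cst; split.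
Qed.

Lemma is_CkD k f g : is_Ck k f -> is_Ck k g -> is_Ck k (f \+ g).
Proof.
elim: k f g => [|k IH] f g [cf df] [cg dg].
  by split=> // x; apply: continuousD; [exact: cf|exact: cg].
split=> [x|i]; first by apply: continuousD; [exact: cf|exact: cg].
have [dfi Cf] := df i; have [dgi Cg] := dg i; split=> [x|].
  exact: derivableD.
by rewrite partialD//; exact: IH.
Qed.

Lemma is_CkM k f g : is_Ck k f -> is_Ck k g -> is_Ck k (f \* g).
Proof.
elim: k f g => [|k IH] f g.
  by move=> [cf _] [cg _]; split=> // x; apply: continuousM; [exact: cf|exact: cg].
move=> Cf Cg; split=> [x|i].
  by apply: continuousM; [exact: is_Ck_continuous Cf _|exact: is_Ck_continuous Cg _].
have [dfi Cfi] := Cf.2 i; have [dgi Cgi] := Cg.2 i; split=> [x|].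
  exact: derivableM.
by rewrite partialM//; apply: is_CkD; apply: IH => //; exact: is_CkS.
Qed.

Lemma is_Ck_sum k (I : Type) (r : seq I) (F : I -> 'rV[R]_d -> R) :
  (forall i, is_Ck k (F i)) -> is_Ck k (fun x => \sum_(i <- r) F i x).
Proof.
move=> CF; elim: r => [|i r IH].
  by rewrite (_ : (fun _ => _) = fun=> 0); [exact: is_Ck_cst|apply/funext => x; rewrite big_nil].
rewrite (_ : (fun _ => _) = F i \+ (fun x => \sum_(i <- r) F i x)); first exact: is_CkD.
by apply/funext => x; rewrite big_cons.
Qed.

Lemma is_Ck_prod k (I : Type) (r : seq I) (F : I -> 'rV[R]_d -> R) :
  (forall i, is_Ck k (F i)) -> is_Ck k (fun x => \prod_(i <- r) F i x).
Proof.
move=> CF; elim: r => [|i r IH].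
  by rewrite (_ : (fun _ => _) = fun=> 1); [exact: is_Ck_cst|apply/funext => x; rewrite big_nil].
rewrite (_ : (fun _ => _) = F i \* (fun x => \prod_(i <- r) F i x)); first exact: is_CkM.
by apply/funext => x; rewrite big_cons.
Qed.

Lemma is_Ck_det k n (A : 'rV[R]_d -> 'M[R]_n) :
  (forall i j, is_Ck k (fun x => A x i j)) -> is_Ck k (fun x => \det (A x)).
Proof.
move=> CA; apply: is_Ck_sum => s; apply: is_CkM; first exact: is_Ck_cst.
by apply: is_Ck_prod => i; exact: CA.
Qed.

(** Since [(1/f)' = - f' / f^2], regularity of order [k] for [1/f] yields order [k.+1]. *)
Lemma is_CkV k f : (forall x, f x != 0) -> is_Ck k f -> is_Ck k (fun x => (f x)^-1).
Proof.
move=> f0; elim: k => [[cf _]|k IH Cf].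
  by split=> // x; apply: continuousV => //; exact: cf.
split=> [x|i]; first by apply: continuousV => //; exact: is_Ck_continuous Cf _.
have [dfi Cfi] := Cf.2 i; split=> [x|]; first exact: derivableV.
rewrite (_ : partial _ _ = (fun=> -1) \* ((fun x => (f x)^-1) \* (fun x => (f x)^-1)) \* partial i f).
  have CV := IH (is_CkS Cf).
  by apply: is_CkM => //; apply: is_CkM; [exact: is_Ck_cst|exact: is_CkM].
apply/funext => x; rewrite /partial deriveV//= /GRing.scale/= expr2 invfM; ring.
Qed.

(** Since [(sqrt f)' = f' / (2 sqrt f)], the induction runs as for the inverse. *)
Lemma is_Ck_sqrt k f : (forall x, 0 < f x) -> is_Ck k f ->
  is_Ck k (fun x => Num.sqrt (f x)).
Proof.
move=> f0; elim: k => [[cf _]|k IH Cf].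
  split=> // x; apply: (@cvg_comp _ _ _ f Num.sqrt _ (nbhs (f x))); first exact: cf.
  exact: sqrt_continuous.
have cs : continuous (fun x => Num.sqrt (f x)).
  exact: is_Ck_continuous (IH (is_CkS Cf)).
split=> // i.
have [dfi Cfi] := Cf.2 i.
have dE x : is_derive x (delta_mx ord0 i) (fun x => Num.sqrt (f x))
    (2^-1 * (Num.sqrt (f x))^-1 * partial i f x).
  apply/is_derive_at0.
  have /is_derive_at0 df : is_derive x (delta_mx ord0 i) f (partial i f x).
    exact/derivableP.
  have := @is_derive1_comp _ Num.sqrt _ (0 : R) _ _ _ df.
  rewrite scale0r addr0 -invfM; apply.
  exact: is_derive1_sqrt.
split=> [x|]; first by case: (dE x).
rewrite (_ : partial _ _ = (fun=> 2^-1) \* (fun x => (Num.sqrt (f x))^-1) \* partial i f).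
  apply: is_CkM => //; apply: is_CkM; first exact: is_Ck_cst.
  by apply: is_CkV; [move=> x; rewrite gt_eqF// sqrtr_gt0|exact/IH/is_CkS].
by apply/funext => x; rewrite /partial; case: (dE x).
Qed.

(** The chain rule along a line, from continuous partial derivatives only.  The
    direction [v] is built up one coordinate at a time: for an increment along a basis
    vector the mean value theorem applies on a segment whose base point moves, and
    continuity of that partial derivative at [x] absorbs the displacement. *)
Lemma is_Ck_derive_line f : is_Ck 1 f -> forall x v (t : R),
  is_derive t 1 (fun r : R => f (x + r *: v))
    (\sum_i v ord0 i * partial i f (x + t *: v)).
Proof.
move=> Cf.
pose L (v x : 'rV[R]_d) := \sum_i v ord0 i * partial i f x.
suff H v : forall x, is_derive (0 : R) 1 (fun r : R => f (x + r *: v)) (L v x).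
  by move=> x v t; apply: (is_derive_line f x v t _).1; apply: (is_derive_at0 f _ v _).2; exact: H.
have vE : v = \sum_(i <- index_enum 'I_d) v ord0 i *: delta_mx ord0 i.
  exact: row_sum_delta.
rewrite vE; elim: (index_enum _) => [|i s IH] x.
  have -> : (fun r : R => f (x + r *: \sum_(i <- [::]) v ord0 i *: delta_mx ord0 i)) = cst (f x).
    by apply/funext => r; rewrite big_nil scaler0 addr0.
  apply: is_derive_eq; rewrite /L big1// => i _.
  by rewrite big_nil mxE mul0r.
rewrite big_cons; set w := \sum_(j <- s) _ in IH *; set c := v ord0 i.
have LE : L (c *: delta_mx ord0 i + w) x = c * partial i f x + L w x.
  rewrite /L (bigD1 i)//= [X in _ = _ + X](bigD1 i)//= !mxE !eqxx mulr1 mulrDl.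
  rewrite -!addrA; congr (_ + (_ + _)); apply: eq_bigr => j ji.
  by rewrite !mxE (negbTE ji) andbF mulr0 add0r.
rewrite LE; apply/is_derive_expansion => e e0.
have e20 : 0 < e / 2 by rewrite divr_gt0.
have [d1 d10 H1] := (is_derive_expansion _ _ _).1 (IH x) _ e20.
pose eta := e / 2 / (`|c| + 1).
have c10 : 0 < `|c| + 1 by rewrite ltr_wpDl.
have eta0 : 0 < eta by rewrite divr_gt0.
have cp : continuous (partial i f) by case: (Cf.2 i) => _ [].
have := cp x => /cvgrPdist_le/(_ _ eta0)/nbhs_ballP[d2/= d20 H2].
(* B bounds the displacement from x divided by |h| *)
pose B := `|w| + `|c| + 1.
have B0 : 0 < B by rewrite ltr_wpDl// addr_ge0.
exists (Num.min d1 (d2 / B)) => [|h]; first by rewrite lt_min d10 divr_gt0.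
rewrite lt_min => /andP[hd1 hd2].
have := H1 h hd1; rewrite !add0r !scale0r !addr0 => {}H1.
have line (y : 'rV[R]_d) (r : R) :
    is_derive r 1 (fun r => f (y + r *: delta_mx ord0 i)) (partial i f (y + r *: delta_mx ord0 i)).
  by apply: (is_derive_line f y _ r _).1; apply: derivableP; exact: (Cf.2 i).1.
have := @derive_mvt_le R _ _ 0 (h * c) (partial i f x) eta (line (x + h *: w)).
rewrite subr0 scale0r addr0 => H3.
have {}H3 : `|f (x + h *: w + h * c *: delta_mx ord0 i) - f (x + h *: w) - h * c * partial i f x| <= eta * `|h * c|.
  apply: H3 => t; rewrite subr0 => tc.
  rewrite distrC; apply: H2; rewrite mx_norm_ball /ball_/= distrC addrAC [x + _ - x]addrAC subrr add0r.
  rewrite (le_lt_trans (ler_normD _ _))// !normrZ.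
  have de : `|(delta_mx ord0 i : 'rV[R]_d)| <= 1.
    apply/mx_norm_le => // j; rewrite mxE; case: (_ && _); by rewrite ?normr1 ?normr0.
  rewrite ltr_pdivlMr// in hd2; apply: le_lt_trans hd2.
  rewrite /B !mulrDr mulr1 -addrA lerD2l -normrM (le_trans (ler_pM _ _ tc de))// mulr1.
  by rewrite lerDl.
have -> : x + h *: (c *: delta_mx ord0 i + w) = x + h *: w + h * c *: delta_mx ord0 i.
  by rewrite scalerDr scalerA addrA addrAC.
have -> : f (x + h *: w + h * c *: delta_mx ord0 i) - f x - h * (c * partial i f x + L w x) =
  (f (x + h *: w + h * c *: delta_mx ord0 i) - f (x + h *: w) - h * c * partial i f x) +
  (f (x + h *: w) - f x - h * L w x) by ring.
have -> : e * `|h| = e / 2 * `|h| + e / 2 * `|h| by rewrite -mulrDl -splitr.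
rewrite (le_trans (ler_normD _ _))// lerD//.
rewrite (le_trans H3)// normrM /eta.
have -> : e / 2 / (`|c| + 1) * (`|h| * `|c|) = e / 2 * `|h| * (`|c| / (`|c| + 1)).
  by ring.
apply: ler_piMr; first by rewrite mulr_ge0// ltW.
by rewrite ler_pdivrMr// mul1r lerDl.
Qed.

End Ck.

(** * The Euclidean square norm and centred Gaussians *)
Section sqn.
Context {R : realType} (d : nat).
Implicit Types z : 'rV[R]_d.

Definition sqn z : R := \sum_i z ord0 i ^+ 2.

Lemma sqn_ge0 z : 0 <= sqn z. Proof. by apply: sumr_ge0 => i _; exact: sqr_ge0. Qed.

Lemma sqn_mulmx z : sqn z = (z *m z^T) ord0 ord0.
Proof. by rewrite mxE; apply: eq_bigr => i _; rewrite mxE expr2. Qed.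

Lemma sqr_coord_le_sqn z i : z ord0 i ^+ 2 <= sqn z.
Proof.
by rewrite /sqn (bigD1 i)//= lerDl; apply: sumr_ge0 => j _; exact: sqr_ge0.
Qed.

Lemma sqnZ c z : sqn (c *: z) = c ^+ 2 * sqn z.
Proof. by rewrite /sqn mulr_sumr; apply: eq_bigr => i _; rewrite mxE exprMn. Qed.

Lemma sqnD_le x z : sqn (x + z) <= 2 * sqn x + 2 * sqn z.
Proof.
rewrite /sqn !mulr_sumr -big_split/=; apply: ler_sum => i _; rewrite !mxE.
have := sqr_ge0 (x ord0 i - z ord0 i); lra.
Qed.

Lemma sqn_eq0 z : (sqn z == 0) = (z == 0).
Proof.
apply/idP/eqP => [|->]; last by rewrite /sqn big1// => i _; rewrite mxE expr0n.
rewrite /sqn psumr_eq0 => [/allP z0|i _]; last exact: sqr_ge0.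
apply/rowP => i; rewrite mxE; apply/eqP; rewrite -sqrf_eq0.
by apply: z0; rewrite mem_index_enum.
Qed.

Lemma sqn_le_norm z r : `|z| <= r -> sqn z <= d%:R * r ^+ 2.
Proof.
move=> zr; have r0 : 0 <= r by apply: le_trans zr.
rewrite /sqn -[d in d%:R]card_ord -sum1_card natr_sum mulr_suml.
apply: ler_sum => i _; rewrite mul1r -[leLHS]real_normK ?num_real// ler_sqr ?nnegrE//.
exact: (mx_norm_le z r0).1.
Qed.

Lemma quadf_scalar c z : quadf c%:M z = c * sqn z.
Proof. by rewrite /quadf mul_mx_scalar -scalemxAl mxE sqn_mulmx. Qed.

Lemma measurable_sqn : measurable_fun setT sqn.
Proof.
rewrite (_ : sqn = quadf 1%:M); first exact: measurable_quadf.
by apply/funext => z; rewrite quadf_scalar mul1r.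
Qed.

Lemma measurable_gauss c : measurable_fun setT (fun z => expR (c * sqn z)).
Proof.
apply: measurableT_comp => //.
by apply: measurable_funM => //; exact: measurable_sqn.
Qed.

Lemma integrable_gauss e : 0 < e ->
  (lebesgue_rV R d).-integrable setT (EFin \o (fun z => expR (- e * sqn z))).
Proof.
move=> e0; apply/integrableP; split.
  by apply/measurable_EFinP; exact: measurable_gauss.
have [||_ I] := @gauss_integral_rV R d (2 * e)%:M.
- by rewrite tr_scalar_mx.
- move=> z z0; rewrite quadf_scalar mulr_gt0// ?mulr_gt0//.
  by rewrite lt0r sqn_eq0 z0 sqn_ge0.
rewrite (_ : integral _ _ _ = \int[lebesgue_rV R d]_z (expR (- 2^-1 * quadf (2 * e)%:M z))%:E)%E.
  by rewrite I ltry.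
apply: eq_integral => z _ /=; rewrite ger0_norm ?expR_ge0// quadf_scalar.
by congr (expR _)%:E; field.
Qed.

(** Any Gaussian factor, however flat, beats a polynomial weight. *)
Lemma coord_le_expR z i e : 0 < e -> `|z ord0 i| <= (1 + e^-1) * expR (e * sqn z).
Proof.
move=> e0; have h1 := expR_ge1Dx (e * sqn z).
have h2 := sqr_coord_le_sqn z i.
have h3 : `|z ord0 i| <= 1 + z ord0 i ^+ 2.
  have := sqr_ge0 (`|z ord0 i| - 1); have := normr_ge0 (z ord0 i).
  rewrite -[z ord0 i ^+ 2]real_normK ?num_real//; nra.
have h4 : 1 <= expR (e * sqn z).
  by rewrite (le_trans _ h1)// lerDl mulr_ge0 ?sqn_ge0// ltW.
have h5 : sqn z <= e^-1 * expR (e * sqn z).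
  rewrite mulrC ler_pdivlMr// mulrC; lra.
rewrite mulrDl mul1r; lra.
Qed.

End sqn.

(** * Polynomial symbols and functions with Gaussian decay *)
Section symbols.
Context {R : realType} (d : nat).

(** A function of a point [x], a step [s] (the square root of the time step) and a
    normalised increment [z]. *)
Definition sfun := 'rV[R]_d -> R -> 'rV[R]_d -> R.
Implicit Types (F G P Q : sfun) (k : nat).

(** Polynomials in [s] and the coordinates of [z] with coefficients of class C^k in [x].
    Both the exponent of the Gaussian and the factors that its derivatives bring down
    belong to this class, and it is stable under differentiation in [x] and [s] at the
    cost of one order of regularity. *)
Inductive symb (k : nat) : sfun -> Prop :=
| symb_coef f : is_Ck k f -> symb k (fun x _ _ => f x)
| symb_s : symb k (fun _ s _ => s)
| symb_z i : symb k (fun _ _ z => z ord0 i)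
| symbD P Q : symb k P -> symb k Q -> symb k (fun x s z => P x s z + Q x s z)
| symbM P Q : symb k P -> symb k Q -> symb k (fun x s z => P x s z * Q x s z).

Lemma symb_cst k (c : R) : symb k (fun _ _ _ => c).
Proof. exact: symb_coef (is_Ck_cst _ _ _). Qed.

Lemma symb_sum k (I : Type) (r : seq I) (P : I -> sfun) :
  (forall i, symb k (P i)) -> symb k (fun x s z => \sum_(i <- r) P i x s z).
Proof.
move=> sP; elim: r => [|i r IH].
  rewrite (_ : (fun _ _ _ => _) = fun _ _ _ => 0); first exact: symb_cst.
  by apply/funext => x; apply/funext => s; apply/funext => z; rewrite big_nil.
rewrite (_ : (fun _ _ _ => _) = fun x s z => P i x s z + \sum_(i <- r) P i x s z).
  exact: symbD.
by apply/funext => x; apply/funext => s; apply/funext => z; rewrite big_cons.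
Qed.

Lemma symbS k P : symb k.+1 P -> symb k P.
Proof.
elim=> [f Cf||i|{}P Q _ sP _ sQ|{}P Q _ sP _ sQ].
- exact/symb_coef/is_CkS.
- exact: symb_s.
- exact: symb_z.
- exact: symbD.
- exact: symbM.
Qed.

(** [Fs] and [Fi] are the partial derivatives of [F] in [s] and in [x].  Asking for the
    chain rule along all lines allows the direction to depend on [z], which is what
    differentiation along [s |-> y - s *: z] needs. *)
Definition gradient F Fs (Fi : 'I_d -> sfun) := forall x s z v r,
  is_derive (0 : R) 1 (fun t : R => F (x + t *: v) (s + t * r) z)
    (r * Fs x s z + \sum_i v ord0 i * Fi i x s z).

Lemma gradientD F Fs Fi G Gs Gi : gradient F Fs Fi -> gradient G Gs Gi ->
  gradient (fun x s z => F x s z + G x s z) (fun x s z => Fs x s z + Gs x s z)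
    (fun i x s z => Fi i x s z + Gi i x s z).
Proof.
move=> gF gG x s z v r; apply: is_derive_eq (is_deriveD (gF x s z v r) (gG x s z v r)) _.
rewrite mulrDr -!addrA; congr (_ + _); rewrite addrCA; congr (_ + _).
by rewrite -big_split; apply: eq_bigr => i _; rewrite mulrDr.
Qed.

Lemma gradientM F Fs Fi G Gs Gi : gradient F Fs Fi -> gradient G Gs Gi ->
  gradient (fun x s z => F x s z * G x s z)
    (fun x s z => F x s z * Gs x s z + G x s z * Fs x s z)
    (fun i x s z => F x s z * Gi i x s z + G x s z * Fi i x s z).
Proof.
move=> gF gG x s z v r; apply: is_derive_eq (is_deriveM (gF x s z v r) (gG x s z v r)) _.
rewrite /= !scale0r !mul0r !addr0 /GRing.scale/= !mulrDr !mulr_sumr addrACA.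
rewrite -big_split/=; congr (_ + _ + _); [ring|ring|].
by apply: eq_bigr => i _; ring.
Qed.

Lemma gradient_expR F Fs Fi : gradient F Fs Fi ->
  gradient (fun x s z => expR (F x s z)) (fun x s z => Fs x s z * expR (F x s z))
    (fun i x s z => Fi i x s z * expR (F x s z)).
Proof.
move=> gF x s z v r.
have H := @is_derive1_comp _ expR _ (0 : R) _ _ (is_derive_expR _) (gF x s z v r).
apply: (is_derive_eq H); rewrite /= scale0r mul0r !addr0 mulrDr mulr_sumr.
by congr (_ + _); [ring|apply: eq_bigr => i _; ring].
Qed.

Lemma is_Ck1 k f : @is_Ck R d k.+1 f -> is_Ck 1 f.
Proof. by elim: k => // k IH /is_CkS/IH. Qed.

Lemma symb_gradient k P : symb k.+1 P ->
  exists Ps Pi, [/\ symb k Ps, (forall i, symb k (Pi i)) & gradient P Ps Pi].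
Proof.
elim=> [f Cf||i|{}P Q sP [Ps [Pi [h1 h2 h3]]] sQ [Qs [Qi [h4 h5 h6]]]
               |{}P Q sP [Ps [Pi [h1 h2 h3]]] sQ [Qs [Qi [h4 h5 h6]]]].
- exists (fun _ _ _ => 0), (fun i x _ _ => partial i f x); split.
  + exact: symb_cst.
  + by move=> i; apply: symb_coef; exact: (Cf.2 i).2.
  + move=> x s z v r; rewrite mulr0 add0r.
    by have := is_Ck_derive_line (is_Ck1 Cf) x v 0; rewrite scale0r addr0.
- exists (fun _ _ _ => 1), (fun _ _ _ _ => 0); split; try by move=> *; exact: symb_cst.
  move=> x s z v r.
  have dd := (is_derive_line (@id R) s r 0 r).1 (is_derive_id _ _).
  apply: (is_derive_eq dd).
  by rewrite big1 ?addr0 ?mulr1// => i _; rewrite mulr0.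
- exists (fun _ _ _ => 0), (fun _ _ _ _ => 0); split; try by move=> *; exact: symb_cst.
  move=> x s z v r; apply: is_derive_eq.
  by rewrite big1 ?addr0 ?mulr0// => j _; rewrite mulr0.
- exists (fun x s z => Ps x s z + Qs x s z), (fun i x s z => Pi i x s z + Qi i x s z).
  by split; [exact: symbD|move=> i; exact: symbD|exact: gradientD].
- exists (fun x s z => P x s z * Qs x s z + Q x s z * Ps x s z),
    (fun i x s z => P x s z * Qi i x s z + Q x s z * Pi i x s z).
  move/symbS : sP => sP; move/symbS : sQ => sQ.
  by split; [apply: symbD; exact: symbM|move=> i; apply: symbD; exact: symbM|exact: gradientM].
Qed.

(** Growth in [z] slower than every Gaussian, locally uniformly in [x] and [s]. *)
Definition tame P := forall rho e, 0 < e -> exists2 C, 0 <= C &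
  forall x s z, `|x| <= rho -> `|s| <= rho -> `|P x s z| <= C * expR (e * sqn z).

Lemma tame_bounded P : (forall rho, exists2 C, 0 <= C &
  forall x s z, `|x| <= rho -> `|s| <= rho -> `|P x s z| <= C) -> tame P.
Proof.
move=> H rho e e0; have [C C0 {}H] := H rho; exists C => // x s z xr sr.
rewrite (le_trans (H x s z xr sr))// ler_peMr//.
by rewrite (le_trans _ (expR_ge1Dx _))// lerDl mulr_ge0 ?sqn_ge0// ltW.
Qed.

(** Closed balls are compact. *)
Lemma continuous_bounded (f : 'rV[R]_d -> R) : continuous f ->
  forall rho, exists2 C, 0 <= C & forall x, `|x| <= rho -> `|f x| <= C.
Proof.
move=> cf rho; have [rho0|rho0] := ltP rho 0.
  by exists 0 => // x xr; have := le_lt_trans xr rho0; rewrite normr_lt0.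
pose A := [set x : 'rV[R]_d | `|x| <= rho].
have A0 : A !=set0 by exists 0; rewrite /A/= normr0.
have cA : compact A.
  apply: bounded_closed_compact.
    by exists rho; split; [exact: num_real|move=> r rr x /le_trans; apply; exact: ltW].
  have -> : A = (fun x => `|x|) @^-1` [set r | r <= rho] by [].
  have /continuous_closedP nc : continuous (fun x : 'rV[R]_d => `|x|) by exact: norm_continuous.
  by apply: nc; exact: closed_le.
have [c Ac H] := EVT_max_rV A0 cA (continuous_subspaceT (fun x => continuous_comp (cf x) (@norm_continuous _ _ (f x)))).
exists `|f c| => // x xr; apply: H; exact/mem_set.
Qed.

Lemma symb_tame k P : symb k P -> tame P.
Proof.
elim=> [f Cf||i|{}P Q _ sP _ sQ|{}P Q _ sP _ sQ].
- apply: tame_bounded => rho.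
  have [C C0 H] := continuous_bounded (is_Ck_continuous Cf) rho.
  by exists C => // x s z xr _; exact: H.
- by apply: tame_bounded => rho; exists `|rho| => // x s z _ sr; rewrite (le_trans sr)// ler_norm.
- move=> rho e e0; exists (1 + e^-1); first by rewrite addr_ge0// invr_ge0 ltW.
  by move=> x s z _ _; exact: coord_le_expR.
- move=> rho e e0; have [C C0 H1] := sP rho e e0; have [D D0 H2] := sQ rho e e0.
  exists (C + D); first exact: addr_ge0.
  move=> x s z xr sr; rewrite (le_trans (ler_normD _ _))// mulrDl.
  by rewrite lerD// ?H1 ?H2.
- move=> rho e e0; have e20 : 0 < e / 2 by rewrite divr_gt0.
  have [C C0 H1] := sP rho _ e20; have [D D0 H2] := sQ rho _ e20.
  exists (C * D); first exact: mulr_ge0.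
  move=> x s z xr sr; rewrite normrM.
  rewrite [e in leRHS]splitr mulrDl expRD mulrACA.
  by rewrite ler_pM// ?H1 ?H2.
Qed.

Lemma symb_measurable k P x s : symb k P -> measurable_fun setT (P x s).
Proof.
elim=> [f Cf||i|{}P Q _ sP _ sQ|{}P Q _ sP _ sQ] //.
- exact: measurable_coord.
- exact: measurable_funD.
- exact: measurable_funM.
Qed.

Definition gaussian_bounded F := (forall x s, measurable_fun setT (F x s)) /\
  forall rho, exists2 e, 0 < e & exists2 C, 0 <= C &
  forall x s z, `|x| <= rho -> `|s| <= rho -> `|F x s z| <= C * expR (- e * sqn z).

(** Functions with [k] derivatives in [(x, s)], all of which have Gaussian decay in
    [z], locally uniformly.  This is the only information about the one-step density that
    differentiation under the integral and Taylor's formula use. *)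
Fixpoint gaussian_class k F : Prop := gaussian_bounded F /\
  if k is k'.+1 then exists Fs Fi, [/\ gaussian_class k' Fs,
    (forall i, gaussian_class k' (Fi i)) & gradient F Fs Fi] else True.

Lemma gaussian_class_bounded k F : gaussian_class k F -> gaussian_bounded F.
Proof. by case: k => [|k] []. Qed.

Lemma gaussian_classS k F : gaussian_class k.+1 F -> gaussian_class k F.
Proof.
elim: k F => [|k IH] F [bF]; first by move=> _; split.
move=> [Fs [Fi [h1 h2 h3]]]; split => //; exists Fs, Fi; split => //.
  exact: IH.
by move=> i; exact: IH.
Qed.

Lemma gaussian_boundedD F G : gaussian_bounded F -> gaussian_bounded G ->
  gaussian_bounded (fun x s z => F x s z + G x s z).
Proof.
move=> [mF bF] [mG bG]; split=> [x s|rho]; first exact: measurable_funD.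
have [e e0 [C C0 H1]] := bF rho; have [e' e'0 [D D0 H2]] := bG rho.
exists (Num.min e e'); first by rewrite lt_min e0.
exists (C + D); first exact: addr_ge0.
move=> x s z xr sr; rewrite (le_trans (ler_normD _ _))// mulrDl.
have mono (a b : R) : a <= b -> expR (- b * sqn z) <= expR (- a * sqn z).
  by move=> ab; rewrite ler_expR ler_wpM2r ?sqn_ge0// lerN2.
rewrite lerD//.
  by rewrite (le_trans (H1 _ _ _ xr sr))// ler_wpM2l// mono// ge_min lexx.
by rewrite (le_trans (H2 _ _ _ xr sr))// ler_wpM2l// mono// ge_min lexx orbT.
Qed.

(** Half of the decay exponent of [F] pays for the growth of the symbol. *)
Lemma gaussian_boundedM k P F : symb k P -> gaussian_bounded F ->
  gaussian_bounded (fun x s z => P x s z * F x s z).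
Proof.
move=> sP [mF bF]; split=> [x s|rho].
  by apply: measurable_funM => //; exact: symb_measurable sP.
have [e e0 [C C0 H1]] := bF rho; have e20 : 0 < e / 2 by rewrite divr_gt0.
have [D D0 H2] := symb_tame sP rho e20.
exists (e / 2) => //; exists (D * C); first exact: mulr_ge0.
move=> x s z xr sr; rewrite normrM.
have -> : - (e / 2) * sqn z = e / 2 * sqn z + - e * sqn z by field.
by rewrite expRD mulrACA ler_pM// ?H1 ?H2.
Qed.

Lemma gaussian_classD k F G : gaussian_class k F -> gaussian_class k G ->
  gaussian_class k (fun x s z => F x s z + G x s z).
Proof.
elim: k F G => [|k IH] F G [bF dF] [bG dG]; first by split => //; exact: gaussian_boundedD.
split; first exact: gaussian_boundedD.
move: dF dG => [Fs [Fi [h1 h2 h3]]] [Gs [Gi [h4 h5 h6]]].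
exists (fun x s z => Fs x s z + Gs x s z), (fun i x s z => Fi i x s z + Gi i x s z).
by split; [exact: IH|move=> i; exact: IH (h2 i) (h5 i)|exact: gradientD].
Qed.

(** Leibniz' rule; the class is a module over the symbols of the same regularity. *)
Lemma gaussian_classM k P F : symb k P -> gaussian_class k F ->
  gaussian_class k (fun x s z => P x s z * F x s z).
Proof.
elim: k P F => [|k IH] P F sP CF.
  by split => //; apply: gaussian_boundedM sP _; exact: gaussian_class_bounded CF.
split; first by apply: gaussian_boundedM sP _; exact: gaussian_class_bounded CF.
have [bF [Fs [Fi [h1 h2 h3]]]] := CF.
have [Ps [Pi [h4 h5 h6]]] := symb_gradient sP.
exists (fun x s z => P x s z * Fs x s z + Ps x s z * F x s z),
  (fun i x s z => P x s z * Fi i x s z + Pi i x s z * F x s z); split.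
- exact: gaussian_classD (IH _ _ (symbS sP) h1) (IH _ _ h4 (gaussian_classS CF)).
- move=> i.
  exact: gaussian_classD (IH _ _ (symbS sP) (h2 i)) (IH _ _ (h5 i) (gaussian_classS CF)).
- move=> x s z v r; apply: is_derive_eq (gradientM h6 h3 x s z v r) _.
  by congr (_ * _ + _); [ring|apply: eq_bigr => i _; ring].
Qed.

Lemma gaussian_class0 k : gaussian_class k (fun _ _ _ => 0).
Proof.
elim: k => [|k IH]; (split; first by split=> // rho; exists 1 => //; exists 0 => // *;
  rewrite normr0 mul0r) => //.
exists (fun _ _ _ => 0), (fun _ _ _ _ => 0); split => // x s z v r.
by apply: is_derive_eq; rewrite mulr0 big1 ?addr0// => i _; rewrite mulr0.
Qed.

Lemma gaussian_class_sum k (I : Type) (r : seq I) (F : I -> sfun) :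
  (forall i, gaussian_class k (F i)) ->
  gaussian_class k (fun x s z => \sum_(i <- r) F i x s z).
Proof.
move=> CF; elim: r => [|i r IH].
  rewrite (_ : (fun _ _ _ => _) = fun _ _ _ => 0); first exact: gaussian_class0.
  by apply/funext => x; apply/funext => s; apply/funext => z; rewrite big_nil.
rewrite (_ : (fun _ _ _ => _) = fun x s z => F i x s z + \sum_(i <- r) F i x s z).
  exact: gaussian_classD.
by apply/funext => x; apply/funext => s; apply/funext => z; rewrite big_cons.
Qed.

(** Differentiating the exponential only brings down a symbol, so a single bound on
    the exponential itself controls all its derivatives. *)
Lemma gaussian_class_expR k Q : symb k Q ->
  gaussian_bounded (fun x s z => expR (Q x s z)) ->
  gaussian_class k (fun x s z => expR (Q x s z)).
Proof.
elim: k Q => [|k IH] Q sQ bQ; first by [].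
split => //; have [Qs [Qi [h4 h5 h6]]] := symb_gradient sQ.
exists (fun x s z => Qs x s z * expR (Q x s z)),
  (fun i x s z => Qi i x s z * expR (Q x s z)); split.
- exact: gaussian_classM h4 (IH _ (symbS sQ) bQ).
- by move=> i; exact: gaussian_classM (h5 i) (IH _ (symbS sQ) bQ).
- exact: gradient_expR.
Qed.

(** The derivative of [F] in the direction [(- z, 1)], hence the derivative of
    [s |-> F (y - s *: z) s z]. *)
Definition flow F Fs (Fi : 'I_d -> sfun) : sfun :=
  fun x s z => Fs x s z + \sum_i - z ord0 i * Fi i x s z.

Lemma gaussian_class_flow k Fs (Fi : 'I_d -> sfun) F : gaussian_class k Fs ->
  (forall i, gaussian_class k (Fi i)) -> gaussian_class k (flow F Fs Fi).
Proof.
move=> CFs CFi; apply: gaussian_classD => //; apply: gaussian_class_sum => i.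
have sz : symb k (fun _ _ z => -1 * z ord0 i) by exact: symbM (symb_cst _ _) (symb_z _ _).
have := gaussian_classM sz (CFi i); congr (gaussian_class k _).
by apply/funext => x; apply/funext => s; apply/funext => z; rewrite mulN1r.
Qed.

Lemma gradient_flow F Fs (Fi : 'I_d -> sfun) : gradient F Fs Fi -> forall y z (s : R),
  is_derive s 1 (fun s => F (y - s *: z) s z) (flow F Fs Fi (y - s *: z) s z).
Proof.
move=> gF y z s; have H := gF (y - s *: z) s z (- z) 1.
apply/is_derive_expansion => e e0.
have [del del0 K] := (is_derive_expansion _ _ _).1 H _ e0.
exists del => // h hd; have := K h hd.
rewrite add0r scale0r mul0r !addr0 mulr1 mul1r.
have -> : y - s *: z + h *: - z = y - (s + h) *: z.
  by rewrite scalerN -addrA -opprD -scalerDl.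
by under eq_bigr => i _ do rewrite mxE.
Qed.

End symbols.

(** * Differentiation under the integral sign *)
Section derive_integral.
Context {R : realType} (d : nat).
Local Notation mu := (lebesgue_rV R d).
Implicit Types F : @sfun R d.

Lemma integrable_gaussian_bounded F x s : gaussian_bounded F ->
  mu.-integrable setT (EFin \o F x s).
Proof.
move=> [mF bF]; have [e e0 [C C0 H]] := bF (Num.max `|x| `|s|).
apply: (@le_integrable _ _ _ mu _ _ _ (EFin \o (fun z => C * expR (- e * sqn z)))) => //.
- exact/measurable_EFinP.
- move=> z _ /=; rewrite lee_fin (le_trans (H x s z _ _)) ?le_max ?lexx ?orbT//.
  exact: ler_norm.
- rewrite (_ : EFin \o _ = (fun z => C%:E * (expR (- e * sqn z))%:E)%E)//.
  by apply: integrableZl => //; exact: integrable_gauss.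
Qed.

Definition integ F x s := \int[mu]_z F x s z.

(** Along a line with parameter in [-1, 1] the point stays in a fixed ball, where the
    Gaussian decay of the gradient provides the dominating function. *)
Lemma derive_integ F Fs (Fi : 'I_d -> @sfun R d) : gaussian_bounded F ->
  gaussian_bounded Fs -> (forall i, gaussian_bounded (Fi i)) -> gradient F Fs Fi ->
  forall x s v (r : R), is_derive (0 : R) 1 (fun t : R => integ F (x + t *: v) (s + t * r))
    (\int[mu]_z (r * Fs x s z + \sum_i v ord0 i * Fi i x s z)).
Proof.
move=> bF bFs bFi gF x s v r.
pose D : @sfun R d := fun x s z => r * Fs x s z + \sum_i v ord0 i * Fi i x s z.
have [mD bD] : gaussian_bounded D.
  have C0s : gaussian_class 0 Fs by [].
  have C0i i : gaussian_class 0 (Fi i) by split => //; exact: bFi.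
  have h1 := gaussian_classM (@symb_cst R d 0 r) C0s.
  have h2 := gaussian_class_sum (index_enum 'I_d)
    (fun i => gaussian_classM (@symb_cst R d 0 (v ord0 i)) (C0i i)).
  exact: gaussian_class_bounded (gaussian_classD h1 h2).
pose rho := `|x| + `|v| + (`|s| + `|r|).
have [e e0 [C C0 H]] := bD rho.
have dF (t : R) z : is_derive t 1 (fun t => F (x + t *: v) (s + t * r) z)
    (D (x + t *: v) (s + t * r) z).
  have K := gF (x + t *: v) (s + t * r) z v r.
  apply/is_derive_expansion => e' e'0.
  have [del del0 K'] := (is_derive_expansion _ _ _).1 K _ e'0.
  exists del => // h hd; have := K' h hd; rewrite add0r.
  have -> : x + t *: v + h *: v = x + (t + h) *: v by rewrite scalerDl addrA.
  have -> : s + t * r + h * r = s + (t + h) * r by ring.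
  by rewrite scale0r mul0r !addr0.
have I0 : `](-1), 1[%classic (0 : R) by rewrite /= in_itv/= ltrN10 ltr01.
have xr (t : R) : `](-1), 1[%classic t -> `|x + t *: v| <= rho /\ `|s + t * r| <= rho.
  rewrite /= in_itv/= => /andP[t1 t2].
  have tn : `|t| <= 1 by rewrite ler_norml !ltW.
  have h (V : normedModType R) (a c : V) : `|a + t *: c| <= `|a| + `|c|.
    by rewrite (le_trans (ler_normD _ _))// normrZ lerD2l ler_piMl.
  split; first by rewrite (le_trans (h _ _ _))// lerDl addr_ge0.
  by rewrite (le_trans (h _ s r))// lerDr addr_ge0.
pose G (z : 'rV[R]_d) := C * expR (- e * sqn z).
have iF t : `](-1), 1[%classic t -> mu.-integrable setT (EFin \o (fun z => F (x + t *: v) (s + t * r) z)).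
  by move=> _; exact: integrable_gaussian_bounded.
have der (t : R) z : `](-1), 1[%classic t -> [set: 'rV[R]_d] z ->
    derivable ((fun t z => F (x + t *: v) (s + t * r) z) ^~ z) t 1.
  by move=> _ _; case: (dF t z).
have G0 z : 0 <= G z by rewrite mulr_ge0// expR_ge0.
have iG : mu.-integrable setT (EFin \o G).
  rewrite (_ : EFin \o _ = (fun z => C%:E * (expR (- e * sqn z))%:E)%E)//.
  by apply: integrableZl => //; exact: integrable_gauss.
have ub (t : R) z : `](-1), 1[%classic t -> [set: 'rV[R]_d] z ->
    `|partial1of2 (fun t z => F (x + t *: v) (s + t * r) z) t z| <= G z.
  move=> It _; rewrite partial1of2E; case: (dF t z) => _ ->.
  by have [h1 h2] := xr t It; exact: H.
pose f (t : R) z := F (x + t *: v) (s + t * r) z.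
have H1 := @derivable_under_integral R _ _ mu f setT measurableT 0 (-1) 1
  I0 iF der G G0 iG ub.
have H2 := @differentiation_under_integral R _ _ mu f setT measurableT 0 (-1) 1
  I0 iF der G G0 iG ub.
split; first exact: H1.
rewrite -derive1E [LHS]H2.
apply: eq_Rintegral => z _; rewrite partial1of2E; case: (dF 0 z) => _ ->.
by rewrite scale0r mul0r !addr0.
Qed.

Lemma derive_integ_x F Fs (Fi : 'I_d -> @sfun R d) : gaussian_bounded F ->
  gaussian_bounded Fs -> (forall i, gaussian_bounded (Fi i)) -> gradient F Fs Fi ->
  forall x s i, is_derive x (delta_mx ord0 i) (fun x => integ F x s) (integ (Fi i) x s).
Proof.
move=> bF bFs bFi gF x s i.
have := derive_integ bF bFs bFi gF x s (delta_mx ord0 i) 0 => H.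
apply: (is_derive_at0 (fun x => integ F x s) x _ _).2.
have -> : (fun r : R => integ F (x + r *: delta_mx ord0 i) s) =
  (fun t : R => integ F (x + t *: delta_mx ord0 i) (s + t * 0)).
  by apply/funext => t; rewrite mulr0 addr0.
apply: (is_derive_eq H); apply: eq_Rintegral => z _.
rewrite mul0r add0r (bigD1 i)//= mxE !eqxx mul1r big1 ?addr0// => j ji.
by rewrite mxE (negbTE ji) andbF mul0r.
Qed.

Lemma derive_integ_s F Fs (Fi : 'I_d -> @sfun R d) : gaussian_bounded F ->
  gaussian_bounded Fs -> (forall i, gaussian_bounded (Fi i)) -> gradient F Fs Fi ->
  forall x (s : R), is_derive s 1 (fun s => integ F x s) (integ Fs x s).
Proof.
move=> bF bFs bFi gF x s.
have := derive_integ bF bFs bFi gF x s 0 1 => H.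
have E (l : R) : is_derive (0 : R) 1 (fun r : R => integ F x (s + r *: (1 : R))) l ->
    is_derive s 1 (fun s : R => integ F x s) l.
  exact: (is_derive_at0 (fun s : R => integ F x s) s _ _).2.
apply: E; have -> : (fun r : R => integ F x (s + r *: (1 : R))) =
  (fun t : R => integ F (x + t *: 0) (s + t * 1)).
  by apply/funext => t; rewrite scaler0 addr0.
apply: (is_derive_eq H); apply: eq_Rintegral => z _.
by rewrite mul1r big1 ?addr0// => j _; rewrite mxE mul0r.
Qed.

End derive_integral.

(** * Moments of a Gaussian with variable coefficients *)
Section gaussian_moments.
Context {R : realType} (d : nat).
Local Notation mu := (lebesgue_rV R d).
Implicit Types (p : 'rV[R]_d -> 'M[R]_d) (b : 'rV[R]_d -> 'rV[R]_d).

(** The data of a Gaussian field: at each point [x] a precision matrix (inverse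
    covariance) and a drift.  The lower bound is only locally uniform because the
    covariance may be unbounded at infinity. *)
Record precision_field p b : Prop := PrecisionField {
  precision_C4 : forall i j, is_Ck 4 (fun x => p x i j) ;
  drift_C4 : forall i, is_Ck 4 (fun x => b x ord0 i) ;
  precision_sym : forall x, (p x)^T = p x ;
  precision_lb : forall rho, exists2 l : R, 0 < l &
    forall x, `|x| <= rho -> forall z, l * sqn z <= quadf (p x) z }.

(** The Gaussian weight of precision [p x] centred at [s *: b x]; its mass [gmass] is kept
    apart. *)
Definition gexp p b : @sfun R d := fun x s z =>
  expR (- 2^-1 * quadf (p x) (z - s *: b x)).

Definition gmass p x : R := Num.sqrt (2 * pi) ^+ d / Num.sqrt (\det (p x)).

Section one_field.
Variables (p : 'rV[R]_d -> 'M[R]_d) (b : 'rV[R]_d -> 'rV[R]_d).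
Hypothesis pb : precision_field p b.

Lemma gexp_symb : symb 4 (fun x s z => - 2^-1 * quadf (p x) (z - s *: b x)).
Proof.
pose lin i : symb 4 (fun (x : 'rV[R]_d) s (z : 'rV[R]_d) => z ord0 i + -1 * (s * b x ord0 i)) :=
  symbD (symb_z 4 i) (symbM (symb_cst d 4 (-1)) (symbM (symb_s d 4) (symb_coef (drift_C4 pb i)))).
have := symbM (symb_cst d 4 (- 2^-1)) (symb_sum (index_enum 'I_d) (fun i =>
  symb_sum (index_enum 'I_d) (fun j =>
    symbM (symb_coef (precision_C4 pb i j)) (symbM (lin i) (lin j))))).
congr (symb 4 _); apply/funext => x; apply/funext => s; apply/funext => z.
rewrite quadfE; congr (_ * _); apply: eq_bigr => i _; apply: eq_bigr => j _.
by rewrite !mxE; ring.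
Qed.

(** From [|z|^2 <= 2 |z - s b|^2 + 2 s^2 |b|^2] the decay around the centre becomes decay
    around the origin, at half the rate. *)
Lemma gexp_bounded : gaussian_bounded (gexp p b).
Proof.
split=> [x s|rho].
  apply: measurableT_comp => //; exact: symb_measurable gexp_symb.
have [l l0 H] := precision_lb pb rho.
have Cbb : is_Ck 4 (fun x => sqn (b x)).
  apply: is_Ck_sum => i; rewrite (_ : (fun _ => _) = (fun x => b x ord0 i) \* (fun x => b x ord0 i)).
    by apply: is_CkM; exact: drift_C4 pb _.
  by apply/funext => x; rewrite expr2.
have [C C0 HC] := continuous_bounded (is_Ck_continuous Cbb) rho.
exists (l / 4); first by rewrite divr_gt0.
exists (expR (l / 2 * (rho ^+ 2 * C))) => // x s z xr sr.
rewrite ger0_norm ?expR_ge0// /gexp -expRD ler_expR.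
have h1 := H x xr (z - s *: b x).
have h2 : sqn z <= 2 * sqn (z - s *: b x) + 2 * (s ^+ 2 * sqn (b x)).
  by rewrite -sqnZ; apply: le_trans (sqnD_le _ _); rewrite subrK.
have h3 : s ^+ 2 * sqn (b x) <= rho ^+ 2 * C.
  apply: ler_pM; rewrite ?sqr_ge0 ?sqn_ge0//.
    rewrite -[leLHS]real_normK ?num_real// ler_sqr ?nnegrE//.
    by apply: le_trans sr.
  by rewrite (le_trans _ (HC x xr))// ler_norm.
have h4 : l * sqn z <= l * (2 * sqn (z - s *: b x) + 2 * (rho ^+ 2 * C)).
  by rewrite ler_pM2l//; lra.
lra.
Qed.

Lemma gexp_class : gaussian_class 4 (gexp p b).
Proof. exact: gaussian_class_expR gexp_symb gexp_bounded. Qed.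

Lemma precision_pd x z : z != 0 -> 0 < quadf (p x) z.
Proof.
move=> z0; have [l l0 H] := precision_lb pb `|x|.
apply: lt_le_trans (H x (lexx _) z); rewrite mulr_gt0//.
by rewrite lt0r sqn_eq0 z0 sqn_ge0.
Qed.

Lemma integ_gexp x s : integ (gexp p b) x s = gmass p x.
Proof.
have [_ I] := gauss_integral_rV (precision_sym pb x) (@precision_pd x).
pose f z := expR (- 2^-1 * quadf (p x) z).
have mf : measurable_fun setT f.
  by apply: measurableT_comp => //; apply: measurable_funM => //; exact: measurable_quadf.
transitivity (\int[mu]_z f z); last by rewrite /Rintegral I.
rewrite -(Rintegral_affine (- (s *: b x)) (oner_neq0 R) mf).
by apply: eq_Rintegral => z _; rewrite normr1 expr1n mul1r scale1r addrC.
Qed.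

(** Translating by [s *: b x] reduces to the centred case, whose first moment vanishes by
    the reflection [z |-> - z]. *)
Lemma integ_coord_gexp x s i :
  integ (fun x s z => z ord0 i * gexp p b x s z) x s = s * b x ord0 i * gmass p x.
Proof.
have bz : gaussian_bounded (fun x s z => z ord0 i * gexp p b x s z).
  exact: gaussian_boundedM (symb_z 4 i) gexp_bounded.
have g0E z : gexp p b x 0 z = expR (- 2^-1 * quadf (p x) z) by rewrite /gexp scale0r subr0.
pose f (z : 'rV[R]_d) := z ord0 i * gexp p b x 0 z.
have mf : measurable_fun setT f by exact: bz.1.
have if_ : mu.-integrable setT (EFin \o f) by exact: integrable_gaussian_bounded bz.
have f0 : \int[mu]_z f z = 0.
  have := Rintegral_affine 0 (ltac:(by rewrite oppr_eq0 oner_eq0) : (-1 : R) != 0) mf.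
  rewrite (_ : \int[mu]_z _ = - \int[mu]_z f z) => [h|]; first lra.
  rewrite -[RHS]mulN1r -(@RintegralZl _ _ _ mu setT f (-1) measurableT if_).
  apply: eq_Rintegral => z _; rewrite normrN1 expr1n mul1r add0r scaleN1r /f !g0E.
  by rewrite quadfN mxE mulN1r mulNr.
pose g (z : 'rV[R]_d) := (z ord0 i + s * b x ord0 i) * gexp p b x 0 z.
have mg : measurable_fun setT g.
  apply: measurable_funM; last exact: gexp_bounded.1.
  by apply: measurable_funD => //; exact: measurable_coord.
transitivity (\int[mu]_z g z).
  rewrite -(Rintegral_affine (- (s *: b x)) (oner_neq0 R) mg).
  apply: eq_Rintegral => z _; rewrite normr1 expr1n mul1r scale1r /g g0E !mxE.
  by rewrite /gexp [z - _]addrC; congr (_ * _); ring.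
rewrite (_ : Rintegral _ _ _ = \int[mu]_z (f z + s * b x ord0 i * gexp p b x 0 z)).
  have h : mu.-integrable setT (EFin \o gexp p b x 0).
    exact: integrable_gaussian_bounded gexp_bounded.
  rewrite (@RintegralD _ _ _ mu setT f (fun z => s * b x ord0 i * gexp p b x 0 z))//.
    rewrite f0 add0r (@RintegralZl _ _ _ mu setT (gexp p b x 0))//.
    by rewrite -(integ_gexp x 0).
  exact: (integrableZl _ (s * b x ord0 i) h).
by apply: eq_Rintegral => z _; rewrite /g mulrDl.
Qed.

End one_field.

(** Second moments without computing a Gaussian integral again: freeze the precision at
    [p x], take the constant drift [w], and differentiate the first moment
    [s w_i] of the shifted Gaussian at [s = 0].  By the choice of [w] the derivative of the
    weight is [z_j] times the weight. *)
Lemma integ_coord2_gexp p b x (w : 'rV[R]_d) i j : precision_field p b ->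
  w *m p x = delta_mx ord0 j ->
  integ (fun x s z => z ord0 i * (z ord0 j * gexp p b x s z)) x 0 = w ord0 i * gmass p x.
Proof.
move=> pb wp.
(* the frozen field; its drift [w] is unrelated to [b] *)
pose P (_ : 'rV[R]_d) := p x; pose B (_ : 'rV[R]_d) := w.
have PB : precision_field P B.
  split; first by move=> *; exact: is_Ck_cst.
  - by move=> *; exact: is_Ck_cst.
  - by move=> *; exact: precision_sym pb _.
  - move=> rho; have [l l0 H] := precision_lb pb `|x|; exists l => // y _ z.
    exact: H.
have CF := gaussian_classM (symb_z 4 i) (gexp_class PB).
pose F : @sfun R d := fun x s z => z ord0 i * gexp P B x s z.
have [bF [Fs [Fi [h1 h2 h3]]]] : gaussian_class 4 F by exact: CF.
have dI := derive_integ_s bF (@gaussian_class_bounded R d 3 _ h1)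
  (fun k => @gaussian_class_bounded R d 3 _ (h2 k)) h3 0 0.
have mass0 : gmass P 0 = gmass p x by [].
have dI' : is_derive (0 : R) 1 (fun s : R => integ F 0 s) (w ord0 i * gmass p x).
  have -> : (fun s : R => integ F 0 s) = (w ord0 i * gmass p x) \*: (@id R).
    by apply/funext => s; rewrite (integ_coord_gexp PB) /= mass0 /GRing.scale/=; ring.
  by apply: is_derive_eq; rewrite [_ *: _]mulr1.
have -> := is_derive_unique dI' dI.
apply: eq_Rintegral => z _.
have H := h3 0 0 z 0 1.
have gE (t : R) : F (0 + t *: 0) (0 + t * 1) z =
   z ord0 i * expR (- 2^-1 * (quadf (p x) z - 2 * t * z ord0 j + t ^+ 2 * w ord0 j)).
  by rewrite /F /gexp /P /B add0r mulr1 (quadf_shift _ _ (precision_sym pb x) wp).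
have H' : is_derive (0 : R) 1 (fun t : R => F (0 + t *: 0) (0 + t * 1) z)
    (z ord0 i * (z ord0 j * gexp p b x 0 z)).
  rewrite (funext gE) /gexp scale0r subr0.
  pose q : R -> R := cst (- 2^-1 * quadf (p x) z) + z ord0 j \*: (@id R)
    + (- 2^-1 * w ord0 j) \*: ((@id R) ^+ 2).
  have dq : is_derive (0 : R) 1 q (z ord0 j).
    have := is_deriveD (is_deriveD (is_derive_cst (- 2^-1 * quadf (p x) z) (0 : R) 1)
      (is_deriveZ (z ord0 j) (is_derive_id (0 : R) 1)))
      (is_deriveZ (- 2^-1 * w ord0 j) (@is_deriveX _ _ (@id R) 2 0 1 1 (is_derive_id _ _))).
    by move=> K; apply: (is_derive_eq K); rewrite /GRing.scale/= expr1; ring.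
  have := is_deriveZ (z ord0 i) (is_derive1_comp (is_derive_expR _) dq).
  have -> : z ord0 i \*: (expR \o q) = (fun t : R => z ord0 i *
      expR (- 2^-1 * (quadf (p x) z - 2 * t * z ord0 j + t ^+ 2 * w ord0 j))).
    apply/funext => t; rewrite /= /GRing.scale/=; congr (_ * expR _).
    rewrite [RHS](_ : _ = - 2^-1 * quadf (p x) z + z ord0 j * t + - 2^-1 * w ord0 j * t ^+ 2)//.
    by field.
  have -> : q 0 = - 2^-1 * quadf (p x) z.
    rewrite [LHS](_ : _ = - 2^-1 * quadf (p x) z + z ord0 j * 0 + - 2^-1 * w ord0 j * 0 ^+ 2)//.
    by ring.
  by move=> K; apply: (is_derive_eq K); rewrite /GRing.scale/=; ring.
have := is_derive_unique H H'.
rewrite mul1r big1 ?addr0 => [->//|k _]; by rewrite mxE mul0r.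
Qed.

End gaussian_moments.

(** * Symmetrised Taylor expansion *)
Section symmetric_taylor.
Context {R : realType}.

(** Averaging over [s] and [- s] removes the odd terms, and with them any need to
    integrate the first and the third derivative.  The remainder is bounded by four
    applications of the mean value inequality. *)
Lemma symmetric_taylor4 (g0 g1 g2 g3 g4 : R -> R) (s M : R) :
  (forall t : R, is_derive t 1 g0 (g1 t)) -> (forall t : R, is_derive t 1 g1 (g2 t)) ->
  (forall t : R, is_derive t 1 g2 (g3 t)) -> (forall t : R, is_derive t 1 g3 (g4 t)) ->
  0 <= s -> (forall t, `|t| <= s -> `|g4 t| <= M) ->
  `|2^-1 * (g0 s + g0 (- s)) - g0 0 - 2^-1 * s ^+ 2 * g2 0| <= M * s ^+ 4.
Proof.
move=> d0 d1 d2 d3 s0 gM.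
have refl (g dg : R -> R) : (forall t : R, is_derive t 1 g (dg t)) ->
    forall t : R, is_derive t 1 (fun t => g (- t)) (- dg (- t)).
  move=> dg0 t; have N : is_derive t 1 (-%R : R -> R) (-1) by exact: is_deriveNid.
  have K := is_derive1_comp (dg0 (- t)) N.
  by apply: (is_derive_eq K); rewrite mulrN1.
have half (g dg : R -> R) (k : R) : (forall t : R, is_derive t 1 g (dg t)) ->
    forall t : R, is_derive t 1 (fun t => 2^-1 * (g t + k * g (- t))) (2^-1 * (dg t - k * dg (- t))).
  move=> dg0 t; have K := is_deriveZ (2^-1 : R) (is_deriveD (dg0 t) (is_deriveZ k (refl _ _ dg0 t))).
  by apply: (is_derive_eq K); rewrite /GRing.scale/= mulrN.
pose e3 t := 2^-1 * (g3 t + (-1) * g3 (- t)).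
pose e2 t := 2^-1 * (g2 t + 1 * g2 (- t)) - g2 0.
pose e1 t := 2^-1 * (g1 t + (-1) * g1 (- t)) - t * g2 0.
pose e0 t := 2^-1 * (g0 t + 1 * g0 (- t)) - (g0 0 + 2^-1 * t ^+ 2 * g2 0).
have D3 (t : R) : is_derive t 1 e3 (2^-1 * (g4 t - (-1) * g4 (- t))) by exact: half.
have D2 (t : R) : is_derive t 1 e2 (e3 t).
  have K := is_deriveB (half _ _ 1 d2 t) (is_derive_cst (g2 0) t 1).
  by apply: (is_derive_eq K); rewrite /e3 subr0 mulN1r mul1r.
have D1 (t : R) : is_derive t 1 e1 (e2 t).
  have K := is_deriveB (half _ _ (-1) d1 t) (is_deriveZ (g2 0) (is_derive_id t 1)).
  have -> : e1 = (fun t => 2^-1 * (g1 t + (-1) * g1 (- t))) - g2 0 \*: (@id R).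
    by apply/funext => r; rewrite /e1 mulrC [r * _]mulrC [RHS]/=; congr (_ - _); ring.
  by apply: (is_derive_eq K); rewrite /e2 [_ *: _]mulr1; ring.
have D0 (t : R) : is_derive t 1 e0 (e1 t).
  have K := is_deriveB (half _ _ 1 d0 t) (is_deriveD (is_derive_cst (g0 0) t 1)
     (is_deriveZ (2^-1 * g2 0) (@is_deriveX _ _ (@id R) 2 t 1 1 (is_derive_id _ _)))).
  have -> : e0 = (fun t => 2^-1 * (g0 t + 1 * g0 (- t))) - (cst (g0 0) + (2^-1 * g2 0) \*: (@id R) ^+ 2).
    by apply/funext => r; rewrite /e0; congr (_ - (_ + _)); rewrite mulrAC.
  by apply: (is_derive_eq K); rewrite /e1 /GRing.scale/= expr1; field.
have B4 (t : R) : `|t| <= s -> `|2^-1 * (g4 t - (-1) * g4 (- t))| <= M.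
  move=> ts; have h1 := gM t ts; have h2 := gM (- t) (ltac:(by rewrite normrN)).
  rewrite normrM gtr0_norm ?invr_gt0// mulN1r opprK.
  have := ler_normD (g4 t) (g4 (- t)); lra.
have B3 := derive_le D3 (ltac:(by rewrite /e3 oppr0; ring)) B4.
have B2 := derive_le D2 (ltac:(by rewrite /e2 oppr0; field)) B3.
have B1 := derive_le D1 (ltac:(by rewrite /e1 oppr0; ring)) B2.
have B0 := derive_le D0 (ltac:(by rewrite /e0 oppr0; field)) B1.
have := B0 s; rewrite ger0_norm// => /(_ (lexx _)).
by rewrite /e0 mul1r opprD addrA; congr (_ <= _); ring.
Qed.

End symmetric_taylor.

(** * Gradients of weighted sums *)
Section gradients.
Context {R : realType} (d : nat).
Implicit Types F : @sfun R d.

Lemma gradient_weight (k : 'rV[R]_d -> R) F Fs (Fi : 'I_d -> @sfun R d) :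
  gradient F Fs Fi -> gradient (fun x s z => k z * F x s z)
    (fun x s z => k z * Fs x s z) (fun i x s z => k z * Fi i x s z).
Proof.
move=> gF x s z v r; apply: (is_derive_eq (is_deriveZ (k z) (gF x s z v r))).
rewrite /GRing.scale/= mulrDr mulr_sumr; congr (_ + _); first by rewrite mulrCA.
by apply: eq_bigr => i _; rewrite mulrCA.
Qed.

Lemma gradient_sum (I : Type) (r : seq I) (F Fs : I -> @sfun R d)
    (Fi : I -> 'I_d -> @sfun R d) : (forall j, gradient (F j) (Fs j) (Fi j)) ->
  gradient (fun x s z => \sum_(j <- r) F j x s z)
    (fun x s z => \sum_(j <- r) Fs j x s z)
    (fun i x s z => \sum_(j <- r) Fi j i x s z).
Proof.
move=> gF; elim: r => [|j r IH] x s z v q.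
  have -> : (fun t : R => \sum_(j <- [::]) F j (x + t *: v) (s + t * q) z) = cst 0.
    by apply/funext => t; rewrite big_nil.
  apply: (is_derive_eq (is_derive_cst _ _ _)).
  by rewrite big_nil mulr0 big1 ?addr0// => i _; rewrite big_nil mulr0.
have -> : (fun t : R => \sum_(j <- j :: r) F j (x + t *: v) (s + t * q) z) =
  (fun t : R => F j (x + t *: v) (s + t * q) z) +
  (fun t : R => \sum_(j <- r) F j (x + t *: v) (s + t * q) z).
  by apply/funext => t; rewrite big_cons.
apply: (is_derive_eq (is_deriveD (gF j x s z v q) (IH x s z v q))).
rewrite big_cons mulrDr -!addrA; congr (_ + _); rewrite addrCA; congr (_ + _).
by rewrite -big_split/=; apply: eq_bigr => i _; rewrite big_cons mulrDr.
Qed.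

(** If [F] vanishes for [x] in the open set where [|x| > R0], it vanishes along a whole
    piece of each line through such a point. *)
Lemma flow_vanish F Fs (Fi : 'I_d -> @sfun R d) (R0 : R) : gradient F Fs Fi ->
  (forall x s z, R0 < `|x| -> F x s z = 0) ->
  forall x s z, R0 < `|x| -> flow F Fs Fi x s z = 0.
Proof.
move=> gF F0 x s z xR0.
have K := gF x s z (- z) 1.
have -> : flow F Fs Fi x s z = 1 * Fs x s z + \sum_i (- z) ord0 i * Fi i x s z.
  by rewrite mul1r; congr (_ + _); apply: eq_bigr => i _; rewrite mxE.
apply: is_derive_unique K _; apply/is_derive_expansion => e e0.
have z0 : 0 < `|z| + 1 by rewrite ltr_wpDl.
exists ((`|x| - R0) / (`|z| + 1)) => [|h]; first by rewrite divr_gt0// subr_gt0.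
rewrite ltr_pdivlMr// => hd.
rewrite !add0r F0 ?F0 ?scale0r ?addr0//.
  by rewrite mulr0 !subr0 normr0 mulr_ge0// ltW.
have h1 : `|x| <= `|x + h *: - z| + `|h| * `|z|.
  rewrite -normrZ; apply: le_trans (ler_normD _ _).
  by rewrite scalerN subrK.
move: hd; rewrite mulrDr mulr1; have := normr_ge0 h; lra.
Qed.

End gradients.

(** * Expansion of the one-step density *)
Section fokker_planck_expansion.
Context {R : realType} (d : nat).
Local Notation mu := (lebesgue_rV R d).
Local Notation sfun := (@sfun R d).

Lemma gaussian_bounded_coord i (F : sfun) : gaussian_bounded F ->
  gaussian_bounded (fun x s z => z ord0 i * F x s z).
Proof. exact: gaussian_boundedM (symb_z 0 i). Qed.

Lemma integ_scale (k : 'rV[R]_d -> R) (F : sfun) x s : gaussian_bounded F ->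
  integ (fun x s z => k x * F x s z) x s = k x * integ F x s.
Proof.
by move=> bF; apply: RintegralZl => //; exact: integrable_gaussian_bounded.
Qed.

Lemma integ_flow (F Fs : sfun) (Fi : 'I_d -> sfun) x s : gaussian_bounded Fs ->
  (forall i, gaussian_bounded (Fi i)) ->
  integ (flow F Fs Fi) x s =
  integ Fs x s - \sum_i integ (fun x s z => z ord0 i * Fi i x s z) x s.
Proof.
move=> bFs bFi; rewrite -sumrN.
have bN i : gaussian_bounded (fun x s z => - z ord0 i * Fi i x s z).
  have := gaussian_boundedM (symbM (symb_cst d 0 (-1)) (symb_z 0 i)) (bFi i).
  congr gaussian_bounded; apply/funext => {}x; apply/funext => {}s; apply/funext => z.
  by rewrite mulN1r.
have bS (r : seq 'I_d) : gaussian_bounded (fun x s z => \sum_(i <- r) - z ord0 i * Fi i x s z).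
  apply: (@gaussian_class_bounded R d 0); apply: gaussian_class_sum => i.
  by split => //; exact: bN.
rewrite /integ [LHS]RintegralD//; last 2 first.
- exact: integrable_gaussian_bounded.
- exact: integrable_gaussian_bounded (bS _).
congr (_ + _); elim: (index_enum _) => [|i r IH].
  rewrite big_nil /Rintegral; under eq_integral do rewrite big_nil.
  by rewrite integral0.
rewrite big_cons -IH -mulN1r -RintegralZl//; last first.
  exact: integrable_gaussian_bounded (gaussian_bounded_coord i (bFi i)).
rewrite -RintegralD//; last 2 first.
- have := integrable_gaussian_bounded x s (bN i).
  by congr (mu.-integrable _ _); apply/funext => z /=; rewrite mulN1r mulNr.
- exact: integrable_gaussian_bounded (bS _).
by apply: eq_Rintegral => z _; rewrite big_cons mulN1r mulNr.
Qed.

Variables (p a : 'rV[R]_d -> 'M[R]_d) (b : 'rV[R]_d -> 'rV[R]_d).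
Variables (c u : 'rV[R]_d -> R).
Hypotheses (pb : precision_field p b) (ap : forall x, a x *m p x = 1%:M).
Hypothesis Ca : forall i j, is_Ck 4 (fun x => a x i j).
Hypotheses (Cc : is_Ck 4 c) (Cu : is_Ck 4 u).
Hypothesis cu : forall x, c x * gmass p x = u x.

(** The law of one step started from the density [u], as a function of the starting
    point [x], in the variable [z = (y - x) / s]. *)
Definition density : sfun := fun x s z => c x * gexp p b x s z.

Lemma density_class : gaussian_class 4 density.
Proof. exact: gaussian_classM (symb_coef Cc) (gexp_class pb). Qed.

(** Total mass of a Gaussian law; it does not depend on [s], which is why the second
    [s]-derivative of the density integrates to zero. *)
Lemma integ_density x s : integ density x s = u x.
Proof.
by rewrite integ_scale ?(integ_gexp pb)//; exact: gexp_bounded.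
Qed.

Lemma integ_coord_density i x s :
  integ (fun x s z => z ord0 i * density x s z) x s = s * (b x ord0 i * u x).
Proof.
transitivity (integ (fun x s z => c x * (z ord0 i * gexp p b x s z)) x s).
  by apply: eq_Rintegral => z _; rewrite /density mulrCA.
rewrite (integ_scale c _ _ (gaussian_bounded_coord i (gexp_bounded pb))).
rewrite (integ_coord_gexp pb) -cu; ring.
Qed.

Lemma integ_coord2_density i j x :
  integ (fun x s z => z ord0 i * (z ord0 j * density x s z)) x 0 = a x j i * u x.
Proof.
transitivity (integ (fun x s z => c x * (z ord0 i * (z ord0 j * gexp p b x s z))) x 0).
  by apply: eq_Rintegral => z _; rewrite /density; ring.
rewrite (integ_scale c _ _ (gaussian_bounded_coord i (gaussian_bounded_coord j (gexp_bounded pb)))).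
rewrite (@integ_coord2_gexp _ _ _ _ x (row j (a x)) i j pb); last first.
  by rewrite -row_mul ap rowE mulmx1.
rewrite mxE -cu; ring.
Qed.

Section moments.
Variables (Hs Hss : sfun) (Hi Hsi His : 'I_d -> sfun) (Hii : 'I_d -> 'I_d -> sfun).
Hypotheses (bHs : gaussian_bounded Hs) (bHi : forall i, gaussian_bounded (Hi i)).
Hypotheses (bHss : gaussian_bounded Hss) (bHsi : forall i, gaussian_bounded (Hsi i)).
Hypotheses (bHis : forall i, gaussian_bounded (His i))
  (bHii : forall i j, gaussian_bounded (Hii i j)).
Hypotheses (gH : gradient density Hs Hi) (gHs : gradient Hs Hss Hsi)
  (gHi : forall i, gradient (Hi i) (His i) (Hii i)).

Let bH : gaussian_bounded density := gaussian_class_bounded density_class.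

Let bu i x := b x ord0 i * u x.

Lemma bu_partial i j x : is_derive x (delta_mx ord0 j) (bu i) (partial j (bu i) x).
Proof.
have C : is_Ck 4 (bu i) := is_CkM (drift_C4 pb i) Cu.
by apply: derivableP; exact: (C.2 j).1.
Qed.

(** The mass [u x] does not depend on [s]. *)
Lemma integ_Hss x s : integ Hss x s = 0.
Proof.
have Hs0 r : integ Hs x r = 0.
  have K := derive_integ_s bH bHs bHi gH x r.
  apply: is_derive_unique K _.
  have -> : (fun s : R => integ density x s) = cst (u x).
    by apply/funext => t; rewrite integ_density.
  exact: is_derive_cst.
have K := derive_integ_s bHs bHss bHsi gHs x s.
apply: is_derive_unique K _.
have -> : (fun s : R => integ Hs x s) = cst 0 by apply/funext.
exact: is_derive_cst.
Qed.

(** Differentiate the first moment [s b_i u] in [s], then in [x_i]. *)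
Lemma integ_coord_Hsi i x s :
  integ (fun x s z => z ord0 i * Hsi i x s z) x s = partial i (bu i) x.
Proof.
have zs r t : integ (fun x s z => z ord0 i * Hs x s z) r t = bu i r.
  have K := derive_integ_s (gaussian_bounded_coord i bH) (gaussian_bounded_coord i bHs)
    (fun j => gaussian_bounded_coord i (bHi j)) (gradient_weight (fun z => z ord0 i) gH) r t.
  apply: is_derive_unique K _.
  have -> : (fun s : R => integ (fun x s z => z ord0 i * density x s z) r s) = bu i r \*: (@id R).
    by apply/funext => q; rewrite integ_coord_density mulrC.
  by apply: (is_derive_eq (is_deriveZ (bu i r) (is_derive_id t 1))); exact: mulr1.
have K := derive_integ_x (gaussian_bounded_coord i bHs) (gaussian_bounded_coord i bHss)
    (fun j => gaussian_bounded_coord i (bHsi j)) (gradient_weight (fun z => z ord0 i) gHs) x s i.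
apply: is_derive_unique K _.
have -> : (fun x => integ (fun x s z => z ord0 i * Hs x s z) x s) = bu i by apply/funext.
exact: bu_partial.
Qed.

(** Same as above in the other order, [x_i] first; this replaces the symmetry of mixed
    derivatives of the density. *)
Lemma integ_coord_His i x s :
  integ (fun x s z => z ord0 i * His i x s z) x s = partial i (bu i) x.
Proof.
have zi r t : integ (fun x s z => z ord0 i * Hi i x s z) r t = t * partial i (bu i) r.
  have K := derive_integ_x (gaussian_bounded_coord i bH) (gaussian_bounded_coord i bHs)
    (fun j => gaussian_bounded_coord i (bHi j)) (gradient_weight (fun z => z ord0 i) gH) r t i.
  apply: is_derive_unique K _.
  have -> : (fun x => integ (fun x s z => z ord0 i * density x s z) x t) = t \*: bu i.
    by apply/funext => q; rewrite integ_coord_density.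
  exact: is_deriveZ (bu_partial i i r).
have K := derive_integ_s (gaussian_bounded_coord i (bHi i)) (gaussian_bounded_coord i (bHis i))
    (fun j => gaussian_bounded_coord i (bHii i j)) (gradient_weight (fun z => z ord0 i) (gHi i)) x s.
apply: is_derive_unique K _.
have -> : (fun s : R => integ (fun x s z => z ord0 i * Hi i x s z) x s) = partial i (bu i) x \*: (@id R).
  by apply/funext => q; rewrite zi mulrC.
by apply: (is_derive_eq (is_deriveZ _ (is_derive_id s 1))); exact: mulr1.
Qed.

(** Differentiate the second moment [a_ji u] at [s = 0] twice in [x]. *)
Lemma integ_coord2_Hii i j x :
  integ (fun x s z => z ord0 i * (z ord0 j * Hii i j x s z)) x 0 =
  partial j (partial i (fun x => a x j i * u x)) x.
Proof.
pose f := fun x => a x j i * u x.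
have Cf : is_Ck 4 f := is_CkM (Ca j i) Cu.
pose w (z : 'rV[R]_d) := z ord0 i * z ord0 j.
have bw F : gaussian_bounded F -> gaussian_bounded (fun x s z => w z * F x s z).
  exact: gaussian_boundedM (symbM (symb_z 0 i) (symb_z 0 j)).
have zi r : integ (fun x s z => w z * Hi i x s z) r 0 = partial i f r.
  have K := derive_integ_x (bw _ bH) (bw _ bHs) (fun j => bw _ (bHi j)) (gradient_weight w gH) r 0 i.
  apply: is_derive_unique K _.
  have -> : (fun x => integ (fun x s z => w z * density x s z) x 0) = f.
    apply/funext => q; rewrite /f -integ_coord2_density.
    by apply: eq_Rintegral => z _; rewrite mulrA.
  by apply: derivableP; exact: (Cf.2 i).1.
have K := derive_integ_x (bw _ (bHi i)) (bw _ (bHis i)) (fun j => bw _ (bHii i j))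
    (gradient_weight w (gHi i)) x 0 j.
transitivity (integ (fun x s z => w z * Hii i j x s z) x 0).
  by apply: eq_Rintegral => z _; rewrite mulrA.
apply: is_derive_unique K _.
have -> : (fun x => integ (fun x s z => w z * Hi i x s z) x 0) = partial i f by apply/funext.
by apply: derivableP; exact: ((Cf.2 i).2.2 j).1.
Qed.

(** The second derivative of [s |-> density (y - s *: z) s z], written out in terms of the
    second order derivatives of the density. *)
Definition flow2 : sfun :=
  flow density (flow density Hss His) (fun j => flow density (Hsi j) (fun i => Hii i j)).

Lemma gradient_flow1 : gradient (flow density Hs Hi)
  (flow density Hss His) (fun j => flow density (Hsi j) (fun i => Hii i j)).
Proof.
exact: gradientD gHs (gradient_sum (index_enum 'I_d)
  (fun i => gradient_weight (fun z => - z ord0 i) (gHi i))).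
Qed.

(** The Fokker-Planck operator appears: pure [s]-derivatives integrate to zero, each of
    the two mixed terms contributes the divergence of [b u], and the pure [x]-derivatives
    contribute the second derivatives of [a u]. *)
Lemma integ_flow2 x : 2^-1 * integ flow2 x 0 =
  - (\sum_i partial i (bu i) x) +
  2^-1 * \sum_i \sum_j partial i (partial j (fun z => a z i j * u z)) x.
Proof.
have bfl Fs Fi : gaussian_bounded Fs -> (forall i, gaussian_bounded (Fi i)) ->
    gaussian_bounded (flow density Fs Fi).
  move=> h1 h2; apply: (@gaussian_class_bounded R d 0).
  apply: gaussian_class_flow; first by split.
  by move=> i; split => //; exact: h2.
rewrite /flow2 integ_flow; [|exact: bfl|by move=> j; exact: bfl].
rewrite integ_flow// integ_Hss sub0r.
under eq_bigr do rewrite integ_coord_His.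
have -> : \sum_i integ (fun x s z => z ord0 i * flow density (Hsi i) (Hii^~ i) x s z) x 0 =
   \sum_i (partial i (bu i) x - \sum_j partial i (partial j (fun z => a z i j * u z)) x).
  apply: eq_bigr => j _.
  transitivity (integ (flow density (fun x s z => z ord0 j * Hsi j x s z)
      (fun i x s z => z ord0 j * Hii i j x s z)) x 0).
    apply: eq_Rintegral => z _; rewrite /flow mulrDr mulr_sumr; congr (_ + _).
    by apply: eq_bigr => i _; rewrite mulrCA.
  rewrite integ_flow; [|exact: gaussian_bounded_coord|by move=> i; exact: gaussian_bounded_coord].
  rewrite integ_coord_Hsi; congr (_ - _); apply: eq_bigr => i _.
  exact: integ_coord2_Hii.
by rewrite sumrB; field.
Qed.

End moments.

Lemma gaussian_class_gradient k (F : sfun) : gaussian_class k.+1 F -> exists Fs Fi,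
  [/\ gaussian_class k Fs, (forall i, gaussian_class k (Fi i)) & gradient F Fs Fi].
Proof. by case. Qed.

Definition fokker_planck x := - (\sum_i partial i (fun x => b x ord0 i * u x) x) +
  2^-1 * \sum_i \sum_j partial i (partial j (fun z => a z i j * u z)) x.

(** The first four derivatives of the density along [s |-> y - s *: z]; the regularity C^4 of
    the coefficients is spent entirely here. *)
Lemma density_flows : exists H1 H2 H3 H4 : sfun,
  [/\ (forall y z (s : R), is_derive s 1 (fun s => density (y - s *: z) s z) (H1 (y - s *: z) s z)),
      (forall y z (s : R), is_derive s 1 (fun s => H1 (y - s *: z) s z) (H2 (y - s *: z) s z)),
      (forall y z (s : R), is_derive s 1 (fun s => H2 (y - s *: z) s z) (H3 (y - s *: z) s z)) &
      (forall y z (s : R), is_derive s 1 (fun s => H3 (y - s *: z) s z) (H4 (y - s *: z) s z))] /\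
  [/\ gaussian_bounded H2, gaussian_bounded H4, 
      (forall x, 2^-1 * integ H2 x 0 = fokker_planck x) &
      forall rho, (forall x, rho < `|x| -> c x = 0) ->
      forall x s z, rho < `|x| -> H4 x s z = 0].
Proof.
have [Hs [Hi [CHs CHi gH]]] := gaussian_class_gradient density_class.
have [Hss [Hsi [CHss CHsi gHs]]] := gaussian_class_gradient CHs.
have /choice[His] := fun i => gaussian_class_gradient (CHi i).
move=> /choice[Hii HH].
have CHis i : gaussian_class 2 (His i) by case: (HH i).
have CHii i j : gaussian_class 2 (Hii i j) by case: (HH i).
have gHi i : gradient (Hi i) (His i) (Hii i) by case: (HH i).
have g1 := gradient_flow1 gHs gHi.
pose H2 := flow2 Hss Hsi His Hii.
have CH2 : gaussian_class 2 H2.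
  apply: gaussian_class_flow; first exact: gaussian_class_flow.
  by move=> j; apply: gaussian_class_flow.
have [H2s [H2i [C2s C2i g2]]] := gaussian_class_gradient CH2.
have C3 : gaussian_class 1 (flow H2 H2s H2i) by exact: gaussian_class_flow.
have [H3s [H3i [C3s C3i g3]]] := gaussian_class_gradient C3.
exists (flow density Hs Hi), H2, (flow H2 H2s H2i), (flow (flow H2 H2s H2i) H3s H3i).
split; split.
- exact: gradient_flow gH.
- exact: gradient_flow g1.
- exact: gradient_flow g2.
- exact: gradient_flow g3.
- exact: gaussian_class_bounded CH2.
- exact: (gaussian_class_bounded (gaussian_class_flow _ C3s C3i)).
- move=> x; apply: integ_flow2 => //; try by [exact: gH|exact: gHs].
  + exact: gaussian_class_bounded CHs.
  + by move=> i; exact: gaussian_class_bounded (CHi i).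
  + exact: gaussian_class_bounded CHss.
  + by move=> i; exact: gaussian_class_bounded (CHsi i).
  + by move=> i; exact: gaussian_class_bounded (CHis i).
  + by move=> i j; exact: gaussian_class_bounded (CHii i j).
- move=> rho c0.
  have v0 x s z : rho < `|x| -> density x s z = 0 by move=> /c0; rewrite /density => ->; rewrite mul0r.
  have v1 := flow_vanish gH v0.
  have v2 := flow_vanish g1 v1.
  have v3 := flow_vanish g2 v2.
  exact: flow_vanish g3 v3.
Qed.

Lemma measurable_symb_ray k P (y : 'rV[R]_d) s : @symb R d k P ->
  measurable_fun setT (fun z : 'rV[R]_d => P (y - s *: z) s z).
Proof.
elim=> [f Cf||i|{}P Q _ sP _ sQ|{}P Q _ sP _ sQ] //.
- apply: measurableT_comp; first exact: continuous_measurable_rV (is_Ck_continuous Cf).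
  rewrite (_ : (fun z => _) = fun z : 'rV[R]_d => y + (- s) *: z); first exact: measurable_affine_rV.
  by apply/funext => z; rewrite scaleNr.
- exact: measurable_coord.
- exact: measurable_funD.
- exact: measurable_funM.
Qed.

Lemma measurable_density_ray y s : measurable_fun setT (fun z : 'rV[R]_d => density (y - s *: z) s z).
Proof.
apply: measurable_funM; first exact: (measurable_symb_ray y s (symb_coef Cc)).
apply: measurableT_comp => //.
exact: (measurable_symb_ray y s (gexp_symb pb)).
Qed.

Lemma integrable_density_ray y s rho : (forall x, rho < `|x| -> c x = 0) ->
  mu.-integrable setT (EFin \o (fun z => density (y - s *: z) s z)).
Proof.
move=> c0; have [_ bD] := gaussian_class_bounded density_class.
have [e e0 [C C0 H]] := bD (Num.max rho `|s|).
apply: (@le_integrable _ _ _ mu _ _ _ (EFin \o (fun z => C * expR (- e * sqn z)))) => //.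
- by apply/measurable_EFinP; exact: measurable_density_ray.
- move=> z _ /=; rewrite lee_fin [leRHS]ger0_norm ?mulr_ge0 ?expR_ge0//.
  have [h|h] := leP `|y - s *: z| rho.
    by apply: H; rewrite le_max ?h ?lexx ?orbT.
  by rewrite /density c0// mul0r normr0 mulr_ge0// expR_ge0.
- by have := integrableZl measurableT C (integrable_gauss d e0).
Qed.

Lemma density_opp x s z : density x (- s) (- z) = density x s z.
Proof. by rewrite /density /gexp scaleNr -opprD quadfN. Qed.

(** The density is invariant under [(s, z) |-> (- s, - z)], so the integral is even in [s]. *)
Lemma Rintegral_density_ray_opp y s :
  \int[mu]_z density (y - (- s) *: z) (- s) z = \int[mu]_z density (y - s *: z) s z.
Proof.
have N1 : (-1 : R) != 0 by rewrite oppr_eq0 oner_eq0.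
apply: etrans (esym (Rintegral_affine 0 N1 (measurable_density_ray y (- s)))) _.
apply: eq_Rintegral => z _.
by rewrite normrN1 expr1n mul1r add0r scaleN1r scalerN -scaleNr opprK density_opp.
Qed.

(** Integrate the symmetrised Taylor formula.  The fourth derivative carries a factor
    [exp (- e |z|^2)] and vanishes unless [|y - r z| <= rho] for some [|r| <= 1]; then
    [|y|^2 <= 2 d rho^2 + 2 |z|^2], so half of the decay in [z] is traded for decay in [y], which
    makes the remainder integrable in [y]. *)
Lemma density_expansion (rho : R) : (forall x, rho < `|x| -> c x = 0) ->
  exists2 C : R, 0 < C & exists2 e : R, 0 < e & forall s, 0 <= s <= 1 -> forall y,
  `|\int[mu]_z density (y - s *: z) s z - u y - s ^+ 2 * fokker_planck y| <=
  C * s ^+ 4 * expR (- e * sqn y).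
Proof.
move=> c0.
have [H1 [H2 [H3 [H4 [[d0 d1 d2 d3] [b2 b4 iH2 /(_ _ c0) v4]]]]]] := density_flows.
have [e e0 [C C0 H]] := b4.2 (Num.max rho 1).
pose C1 := C * expR (e / 2 * (d%:R * rho ^+ 2)).
have C10 : 0 <= C1 by rewrite mulr_ge0// expR_ge0.
pose e4 := e / 4; pose e2 := e / 2.
have e20 : 0 < e2 by rewrite divr_gt0.
pose J := \int[mu]_z expR (- e2 * sqn z).
have J0 : 0 <= J by apply: Rintegral_ge0 => z _; exact: expR_ge0.
exists (C1 * J + 1); first by rewrite ltr_wpDl// mulr_ge0.
exists e4; first by rewrite divr_gt0.
move=> s /andP[s0 s1] y.
pose M (z : 'rV[R]_d) := C1 * expR (- e4 * sqn y) * expR (- e2 * sqn z).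
have bound z (r : R) : `|r| <= s -> `|H4 (y - r *: z) r z| <= M z.
  move=> rs; have r1 : `|r| <= 1 by apply: le_trans s1.
  have [h|h] := leP `|y - r *: z| rho; last first.
    by rewrite v4// normr0 !mulr_ge0// expR_ge0.
  apply: le_trans (H _ _ _ _ _) _; rewrite ?le_max ?h ?r1 ?orbT//.
  rewrite /M /C1 -!mulrA ler_wpM2l// -!expRD ler_expR.
  have h1 := sqn_le_norm h.
  have h2 : sqn y <= 2 * sqn (y - r *: z) + 2 * sqn (r *: z).
    by apply: le_trans (sqnD_le _ _); rewrite subrK.
  have h3 : sqn (r *: z) <= sqn z.
    rewrite sqnZ ler_piMl ?sqn_ge0// -[leLHS]real_normK ?num_real//.
    by rewrite expr_le1.
  have h4 : e * sqn y <= e * (2 * (d%:R * rho ^+ 2) + 2 * sqn z).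
    by rewrite ler_pM2l//; lra.
  rewrite /e4 /e2; lra.
pose E (z : 'rV[R]_d) := 2^-1 * (density (y - s *: z) s z + density (y - (- s) *: z) (- s) z)
  - density y 0 z - 2^-1 * s ^+ 2 * H2 y 0 z.
have EM z : `|E z| <= M z * s ^+ 4.
  have := symmetric_taylor4 (d0 y z) (d1 y z) (d2 y z) (d3 y z) s0 (bound z).
  by rewrite scale0r subr0.
have i1 := integrable_density_ray y s c0.
have i2 := integrable_density_ray y (- s) c0.
have i3 := integrable_gaussian_bounded y 0 (gaussian_class_bounded density_class).
have i4 := integrable_gaussian_bounded y 0 b2.
have i12 := integrableZl measurableT 2^-1 (integrableD measurableT i1 i2).
have i123 := integrableB measurableT i12 i3.
have i5 := integrableZl measurableT (2^-1 * s ^+ 2) i4.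
have iE := integrableB measurableT i123 i5.
have -> : \int[mu]_z density (y - s *: z) s z - u y - s ^+ 2 * fokker_planck y = \int[mu]_z E z.
  rewrite /E (RintegralB measurableT i123 i5) (RintegralB measurableT i12 i3).
  rewrite (RintegralZl _ measurableT (integrableD measurableT i1 i2)).
  rewrite (RintegralZl _ measurableT i4) (RintegralD measurableT i1 i2).
  have alg (A B D E0 FP U : R) : B = A -> D = U -> 2^-1 * E0 = FP ->
      A - U - s ^+ 2 * FP = 2^-1 * (A + B) - D - 2^-1 * s ^+ 2 * E0.
    by move=> -> -> <-; field.
  exact: alg (Rintegral_density_ray_opp y s) (integ_density y 0) (iH2 y).
apply: le_trans (le_normr_Rintegral measurableT iE) _.
have iM : mu.-integrable setT (EFin \o (fun z => M z * s ^+ 4)).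
  have := integrableZl measurableT (s ^+ 4 * (C1 * expR (- e4 * sqn y))) (integrable_gauss d e20).
  congr (mu.-integrable _ _); apply/funext => z /=; rewrite -EFinM /M; congr EFin; ring.
apply: (@le_trans _ _ (\int[mu]_z (M z * s ^+ 4))).
  apply: le_Rintegral => //; last by move=> z _; exact: EM.
  exact: integrable_norm iE.
rewrite (_ : Rintegral _ _ _ = s ^+ 4 * (C1 * expR (- e4 * sqn y)) * J); last first.
  rewrite -(RintegralZl _ measurableT (integrable_gauss d e20)).
  by apply: eq_Rintegral => z _; rewrite /M; ring.
have := expR_ge0 (- e4 * sqn y); have := exprn_ge0 4 s0; set A := s ^+ 4; set B := expR _.
move=> A0 B0; have AB : 0 <= A * B by rewrite mulr_ge0.
rewrite (_ : _ * J = C1 * J * (A * B)); last by ring.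
have -> : (C1 * J + 1) * A * B = (C1 * J + 1) * (A * B) by ring.
by rewrite ler_wpM2r// lerDl.
Qed.

End fokker_planck_expansion.

(** * The precision matrix of an elliptic diffusion *)
Section diffusion_precision.
Context {R : realType} (d q : nat).
Variables (b : 'rV[R]_d -> 'rV[R]_d) (sigma : 'rV[R]_d -> 'M[R]_(d, q)).
Hypotheses (b_C4 : forall i, is_Ck 4 (fun x => b x ord0 i))
  (sigma_C4 : forall i j, is_Ck 4 (fun x => sigma x i j)).
Variables (alpha : R) (alpha0 : 0 < alpha).
Hypothesis elliptic : forall x y : 'rV[R]_d, (y *m diffusion sigma x *m y^T) ord0 ord0 >=
         alpha * (y *m y^T) ord0 ord0.

Local Notation a := (diffusion sigma).

Definition precision x := invmx (a x).

Lemma diffusion_C4 i j : is_Ck 4 (fun x => a x i j).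
Proof.
have -> : (fun x => a x i j) = (fun x => \sum_k sigma x i k * sigma x j k).
  by apply/funext => x; rewrite mxE; apply: eq_bigr => k _; rewrite mxE.
by apply: is_Ck_sum => k; exact: is_CkM (sigma_C4 i k) (sigma_C4 j k).
Qed.

Lemma diffusion_sym x : (a x)^T = a x.
Proof. by rewrite /diffusion trmx_mul trmxK. Qed.

Lemma diffusion_lb x y : alpha * sqn y <= quadf (a x) y.
Proof. by rewrite sqn_mulmx; exact: elliptic. Qed.

Lemma det_diffusion_gt0 x : 0 < \det (a x).
Proof.
have [|//] := gauss_integral_rV (diffusion_sym x) _; move=> y y0.
apply: lt_le_trans (diffusion_lb x y); rewrite mulr_gt0//.
by rewrite lt0r sqn_eq0 y0 sqn_ge0.
Qed.

Lemma diffusion_unit x : a x \in unitmx.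
Proof. by rewrite unitmxE unitfE gt_eqF// det_diffusion_gt0. Qed.

Lemma precision_coef_C4 i j : is_Ck 4 (fun x => precision x i j).
Proof.
have -> : (fun x => precision x i j) = (fun x => (\det (a x))^-1) \*
    ((fun=> (-1) ^+ (j + i)) \* (fun x => \det (row' j (col' i (a x))))).
  by apply/funext => x; rewrite /precision /invmx diffusion_unit !mxE.
apply: is_CkM; last apply: is_CkM.
- apply: is_CkV; first by move=> x; rewrite gt_eqF// det_diffusion_gt0.
  by apply: is_Ck_det; exact: diffusion_C4.
- exact: is_Ck_cst.
- apply: is_Ck_det => k l.
  have -> : (fun x => row' j (col' i (a x)) k l) = (fun x => a x (lift j k) (lift i l)).
    by apply/funext => x; rewrite !mxE.
  exact: diffusion_C4.
Qed.

(** For [z = w a] one has [z a^-1 z^T = w a w^T >= alpha |w|^2], while [|z|^2 <= K |w|^2] as soon as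
    the entries of [a] are bounded, hence locally uniformly. *)
Lemma precision_field_diffusion : precision_field precision b.
Proof.
split; [exact: precision_coef_C4|exact: b_C4| |].
  by move=> x; rewrite /precision trmx_inv diffusion_sym.
move=> rho.
have /choice[A HA] : forall ij : 'I_d * 'I_d, exists C : R, 0 <= C /\
    forall x, `|x| <= rho -> `|a x ij.1 ij.2| <= C.
  move=> ij; have [C C0 H] := continuous_bounded (is_Ck_continuous (diffusion_C4 ij.1 ij.2)) rho.
  by exists C.
pose B := \sum_ij A ij.
have B0 : 0 <= B by apply: sumr_ge0 => ij _; case: (HA ij).
have aB x i j : `|x| <= rho -> `|a x i j| <= B.
  move=> xr; apply: le_trans ((HA (i, j)).2 x xr) _.
  by rewrite /B (bigD1 (i, j))//= lerDl; apply: sumr_ge0 => ij _; case: (HA ij).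
(* the summand 1 only makes K positive *)
pose K := d%:R * (d%:R * B) ^+ 2 + 1.
have K0 : 0 < K by rewrite ltr_wpDl// mulr_ge0// sqr_ge0.
exists (alpha / K) => [|x xr z]; first exact: divr_gt0.
pose w := z *m precision x.
have zw : z = w *m a x by rewrite /w mulmxKV// diffusion_unit.
have -> : quadf (precision x) z = quadf (a x) w.
  rewrite /quadf -/w {1}zw trmx_mul diffusion_sym mulmxA.
  by [].
apply: le_trans (diffusion_lb x w); rewrite -mulrA ler_pM2l// ler_pdivrMl// .
rewrite {1}/sqn.
have -> : K * sqn w = \sum_(i < d) (d%:R * B) ^+ 2 * sqn w + sqn w.
  by rewrite sumr_const card_ord -[in RHS]mulr_natl /K; ring.
rewrite -[leLHS]addr0 lerD ?sqn_ge0//; apply: ler_sum => j _.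
rewrite {1}zw mxE.
have r0 : 0 <= Num.sqrt (sqn w) by [].
have wi i : `|w ord0 i| <= Num.sqrt (sqn w).
  by rewrite -sqrtr_sqr ler_wsqrtr// sqr_coord_le_sqn.
rewrite -[sqn w]sqr_sqrtr ?sqn_ge0// -exprMn -[leLHS]real_normK ?num_real//.
rewrite ler_sqr ?nnegrE ?mulr_ge0//.
apply: le_trans (ler_norm_sum _ _ _) _.
have -> : d%:R * B * Num.sqrt (sqn w) = \sum_(i < d) (Num.sqrt (sqn w) * B).
  by rewrite sumr_const card_ord -[RHS]mulr_natl; ring.
by apply: ler_sum => i _; rewrite normrM ler_pM// ?wi// aB.
Qed.

Let pb := precision_field_diffusion.

Lemma det_precision x : \det (precision x) = (\det (a x))^-1.
Proof. by rewrite /precision det_inv. Qed.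

Lemma gmass_precision_gt0 x : 0 < gmass precision x.
Proof.
rewrite divr_gt0 ?exprn_gt0// sqrtr_gt0 ?mulr_gt0 ?pi_gt0//.
by rewrite det_precision invr_gt0 det_diffusion_gt0.
Qed.

Lemma div_gmass_C4 u : is_Ck 4 u -> is_Ck 4 (fun x => u x / gmass precision x).
Proof.
move=> Cu; pose k : R := (Num.sqrt (2 * pi) ^+ d)^-1.
have -> : (fun x => u x / gmass precision x) =
    u \* ((fun=> k) \* (fun x => Num.sqrt (\det (precision x)))).
  by apply/funext => x; rewrite /gmass invf_div /k /= [k * _]mulrC.
have dp x : 0 < \det (precision x).
  by rewrite det_precision invr_gt0 det_diffusion_gt0.
have Cs := is_Ck_sqrt dp (is_Ck_det precision_coef_C4).
exact: is_CkM Cu (is_CkM (is_Ck_cst d 4 k) Cs).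
Qed.

End diffusion_precision.

Lemma compact_support_bounded (R : realType) (d : nat) (u : 'rV[R]_d -> R) :
  compact (closure [set x | u x != 0]) ->
  exists rho, forall x, rho < `|x| -> u x = 0.
Proof.
move=> /compact_bounded[M [_ H]]; exists (M + 1) => x xM.
apply/eqP/contraT => u0.
have cx : closure [set x | u x != 0] x by exact: subset_closure.
have := H (M + 1) (ltac:(by rewrite ltrDl)) x cx.
by rewrite /= leNgt xM.
Qed.

(** * The Euler-Maruyama kernel *)
Section kernel.
Context {R : realType} (d q : nat).
Local Notation mu := (lebesgue_rV R d).
Variables (b : 'rV[R]_d -> 'rV[R]_d) (sigma : 'rV[R]_d -> 'M[R]_(d, q)).
Hypotheses (b_C4 : forall i, is_Ck 4 (fun x => b x ord0 i))
  (sigma_C4 : forall i j, is_Ck 4 (fun x => sigma x i j)).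
Variables (alpha : R) (alpha0 : 0 < alpha).
Hypothesis elliptic : forall x y : 'rV[R]_d,
  (y *m diffusion sigma x *m y^T) ord0 ord0 >= alpha * (y *m y^T) ord0 ord0.

Local Notation a := (diffusion sigma).
Local Notation p := (precision sigma).

Let pb : precision_field p b := precision_field_diffusion b_C4 sigma_C4 alpha0 elliptic.
Let m0 x : 0 < gmass p x := gmass_precision_gt0 alpha0 elliptic x.

(** Scaling: at time step [s^2] the kernel at distance [s z] is [s^- d] times a Gaussian of
    precision independent of [s]. *)
Lemma EM_kernelE s y x : 0 < s ->
  s ^+ d * EM_kernel b sigma y x (s ^+ 2) =
  expR (- 2^-1 * (s ^- 2 * quadf (p x) (y - x - s ^+ 2 *: b x))) / gmass p x.
Proof.
move=> s0; have s20 : s ^+ 2 != 0 by rewrite expf_neq0// gt_eqF.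
have da := det_diffusion_gt0 alpha0 elliptic x.
rewrite /EM_kernel mulrCA; congr (expR (- 2^-1 * _) * _).
  rewrite invmxZ; last first.
    by rewrite unitmxE detZ unitrM unitrX ?unitfE// gt_eqF.
  by rewrite /quadf -scalemxAr -scalemxAl mxE.
rewrite detZ normrM ger0_norm; last by rewrite exprn_ge0// exprn_ge0// ltW.
rewrite (gtr0_norm da) sqrtrM; last by rewrite exprn_ge0// exprn_ge0// ltW.
have -> : Num.sqrt ((s ^+ 2) ^+ d) = s ^+ d.
  by rewrite exprAC sqrtr_sqr ger0_norm// exprn_ge0// ltW.
have -> : (2 * pi) `^ (d%:R / 2) = Num.sqrt (2 * pi) ^+ d :> R.
  by rewrite [_ / 2]mulrC powRrM powR_mulrn ?powR_ge0// powR12_sqrt// mulr_ge0// pi_ge0.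
rewrite /gmass (det_precision) sqrtrV ?ltW// invrK.
rewrite [X in _ * X^-1]mulrCA invfM mulrA divff ?mul1r//.
by rewrite expf_neq0// gt_eqF.
Qed.

Lemma EM_kernel_ge0 y x tau : 0 <= EM_kernel b sigma y x tau.
Proof. by rewrite /EM_kernel divr_ge0 ?expR_ge0// mulr_ge0// powR_ge0. Qed.

Lemma EM_kernel_gaussian s y x : 0 < s -> EM_kernel b sigma y x (s ^+ 2) =
  (s ^+ d)^-1 * (expR (- 2^-1 * (s ^- 2 * quadf (p x) (y - x - s ^+ 2 *: b x))) / gmass p x).
Proof.
by move=> s0; rewrite -EM_kernelE// mulKf// expf_neq0// gt_eqF.
Qed.

Lemma measurable_EM_kernel s : 0 < s ->
  measurable_fun setT (fun yx : 'rV[R]_d * 'rV[R]_d => EM_kernel b sigma yx.1 yx.2 (s ^+ 2)).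
Proof.
move=> s0; under eq_fun do rewrite EM_kernel_gaussian//.
have m2 (f : 'rV[R]_d -> R) : continuous f ->
    measurable_fun setT (fun yx : 'rV[R]_d * 'rV[R]_d => f yx.2).
  by move=> cf; exact: measurableT_comp (continuous_measurable_rV cf) measurable_snd.
have Ck_meas (f : 'rV[R]_d -> R) : is_Ck 4 f ->
    measurable_fun setT (fun yx : 'rV[R]_d * 'rV[R]_d => f yx.2).
  by move=> /is_Ck_continuous; exact: m2.
have mw i : measurable_fun setT (fun yx : 'rV[R]_d * 'rV[R]_d =>
    yx.1 ord0 i - yx.2 ord0 i - s ^+ 2 * b yx.2 ord0 i).
  apply: measurable_funB; first apply: measurable_funB.
  - exact: (measurableT_comp (measurable_coord i) measurable_fst).
  - exact: (measurableT_comp (measurable_coord i) measurable_snd).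
  - by apply: measurable_funM => //; exact: (Ck_meas (fun x => b x ord0 i)).
apply: measurable_funM => //; apply: measurable_funM.
  apply: measurableT_comp => //; apply: measurable_funM => //; apply: measurable_funM => //.
  under eq_fun do rewrite quadfE.
  apply: measurable_sum => i; apply: measurable_sum => j; apply: measurable_funM.
    exact: Ck_meas (precision_C4 pb i j).
  under eq_fun do rewrite !mxE.
  exact: measurable_funM (mw i) (mw j).
have := Ck_meas _ (div_gmass_C4 sigma_C4 alpha0 elliptic (is_Ck_cst d 4 1)).
by under eq_fun do rewrite mul1r.
Qed.

(** The substitution [y = x + s^2 b + s z] reduces to the Gaussian of precision [p x]. *)
Lemma integral_EM_kernel s x : 0 < s ->
  (\int[mu]_y (EM_kernel b sigma y x (s ^+ 2))%:E = 1)%E.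
Proof.
move=> s0; have sn : s != 0 by rewrite gt_eqF.
pose f y := (EM_kernel b sigma y x (s ^+ 2))%:E.
have mf : measurable_fun setT f.
  apply/measurable_EFinP.
  exact: measurableT_comp (measurable_EM_kernel s0) (measurable_pair2 x).
have f0 y : (0 <= f y)%E by rewrite lee_fin EM_kernel_ge0.
have sd : 0 < s ^+ d by rewrite exprn_gt0.
have K := ge0_integral_affine (x + s ^+ 2 *: b x) sn mf f0.
have [_ I] := gauss_integral_rV (precision_sym pb x) (precision_pd pb x).
have : (\int[mu]_z f (x + s ^+ 2 *: b x + s *: z)%R = (s ^- d)%:E)%E.
  transitivity (\int[mu]_z ((s ^- d / gmass p x)%:E * (expR (- 2^-1 * quadf (p x) z))%:E))%E.
    apply: eq_integral => z _; rewrite -EFinM /f EM_kernel_gaussian//; congr EFin.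
    have -> : x + s ^+ 2 *: b x + s *: z - x - s ^+ 2 *: b x = s *: z.
      by rewrite -addrA -opprD addrAC subrr add0r.
    rewrite quadfZ mulKf ?expf_neq0//; ring.
  rewrite ge0_integralZl//; last 2 first.
  - apply/measurable_EFinP; apply: measurableT_comp => //.
    by apply: measurable_funM => //; exact: measurable_quadf.
  - by rewrite lee_fin divr_ge0 ?invr_ge0// ltW.
  by rewrite I -EFinM -/(gmass p x) divfK// gt_eqF.
rewrite K ger0_norm ?ltW// => /(congr1 (fun e => (s ^+ d)%:E * e)%E).
by rewrite muleA -!EFinM divff ?gt_eqF// mul1e.
Qed.

Variable u : 'rV[R]_d -> R.
Hypothesis Cu : is_Ck 4 u.
Variable rho : R.
Hypothesis u0 : forall x, rho < `|x| -> u x = 0.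

Local Notation c := (fun x => u x / gmass p x).

(** The substitution [x = y - s z] in the starting point. *)
Lemma EM_propagator_density s y : 0 < s ->
  EM_propagator b sigma (s ^+ 2) u y =
  \int[mu]_z density p b c (y - s *: z) s z.
Proof.
move=> s0; have sn : - s != 0 by rewrite oppr_eq0 gt_eqF.
have mf : measurable_fun setT (fun x => EM_kernel b sigma y x (s ^+ 2) * u x).
  apply: measurable_funM; last exact: continuous_measurable_rV (is_Ck_continuous Cu).
  exact: measurableT_comp (measurable_EM_kernel s0) (measurable_pair1 y).
rewrite /EM_propagator.
apply: etrans (esym (Rintegral_affine y sn mf)) _.
apply: eq_Rintegral => z _; rewrite normrN gtr0_norm// scaleNr mulrA EM_kernelE//.
rewrite /density /gexp opprB addrCA subrr addr0.
have -> : s *: z - s ^+ 2 *: b (y - s *: z) = s *: (z - s *: b (y - s *: z)).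
  by rewrite scalerBr scalerA expr2.
rewrite quadfZ mulKf ?expf_neq0// ?gt_eqF//; ring.
Qed.

Lemma integrable_compact_support : mu.-integrable setT (EFin \o u).
Proof.
have cu := is_Ck_continuous Cu.
have [C C0 H] := continuous_bounded cu rho.
apply: (@le_integrable _ _ _ mu _ _ _
  (EFin \o (fun z => C * expR (d%:R * rho ^+ 2) * expR (- 1 * sqn z)))) => //.
- by apply/measurable_EFinP; exact: continuous_measurable_rV.
- move=> z _ /=; rewrite lee_fin [leRHS]ger0_norm ?mulr_ge0 ?expR_ge0//.
  have [h|h] := leP `|z| rho; last by rewrite u0// normr0 !mulr_ge0 ?expR_ge0.
  rewrite (le_trans (H z h))// -mulrA ler_peMr// -expRD.
  by apply: le_trans (expR_ge1Dx _); have := sqn_le_norm h; lra.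
- exact: integrableZl (integrable_gauss d ltr01).
Qed.

(** Tonelli: the kernel has mass one in its arrival point. *)
Lemma norm1_EM_kernel_mul s : 0 < s ->
  (\int[mu]_y \int[mu]_x `|(EM_kernel b sigma y x (s ^+ 2) * u x)%:E| =
   \int[mu]_x `|(u x)%:E|)%E.
Proof.
move=> s0.
have mk := measurable_EM_kernel s0.
have mu2 : measurable_fun setT (fun yx : 'rV[R]_d * 'rV[R]_d => u yx.2).
  exact: measurableT_comp (continuous_measurable_rV (is_Ck_continuous Cu)) measurable_snd.
have := @fubini_tonelli _ _ _ _ R mu mu
  (fun yx => `|(EM_kernel b sigma yx.1 yx.2 (s ^+ 2) * u yx.2)%:E|)%E => ->//; last first.
  apply: measurableT_comp => //; apply/measurable_EFinP; exact: measurable_funM.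
apply: eq_integral => x _ /=.
under eq_integral => y _ do rewrite normrM EFinM (ger0_norm (EM_kernel_ge0 _ _ _)).
rewrite ge0_integralZr//.
- by rewrite integral_EM_kernel// mul1e.
- apply/measurable_EFinP; exact: measurableT_comp mk (measurable_pair2 x).
- by move=> y _; rewrite lee_fin EM_kernel_ge0.
Qed.

Lemma measurable_EM_propagator s : 0 < s ->
  measurable_fun setT (EM_propagator b sigma (s ^+ 2) u).
Proof.
move=> s0; apply: measurableT_comp => //.
have mk := measurable_EM_kernel s0.
have mu2 : measurable_fun setT (fun yx : 'rV[R]_d * 'rV[R]_d => u yx.2).
  exact: measurableT_comp (continuous_measurable_rV (is_Ck_continuous Cu)) measurable_snd.
have := @measurable_fubini_F _ _ _ _ R mu mu
  (fun yx => (EM_kernel b sigma yx.1 yx.2 (s ^+ 2) * u yx.2)%:E); apply.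
apply/integrable12ltyP; first by apply/measurable_EFinP; exact: measurable_funM.
rewrite norm1_EM_kernel_mul//.
by have /integrableP[_] := integrable_compact_support.
Qed.

Lemma le_norm1_EM_propagator s : 0 < s ->
  (\int[mu]_y `|(EM_propagator b sigma (s ^+ 2) u y)%:E| <= \int[mu]_x `|(u x)%:E|)%E.
Proof.
move=> s0; rewrite -(norm1_EM_kernel_mul s0).
have mk := measurable_EM_kernel s0.
have mu2 : measurable_fun setT (fun yx : 'rV[R]_d * 'rV[R]_d => u yx.2).
  exact: measurableT_comp (continuous_measurable_rV (is_Ck_continuous Cu)) measurable_snd.
have mku : measurable_fun setT (fun yx : 'rV[R]_d * 'rV[R]_d =>
    (EM_kernel b sigma yx.1 yx.2 (s ^+ 2) * u yx.2)%:E).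
  by apply/measurable_EFinP; exact: measurable_funM.
apply: ge0_le_integral => //.
- by apply: measurableT_comp => //; apply/measurable_EFinP; exact: measurable_EM_propagator.
- exact: (measurable_fun_fubini_tonelli_F
    (fun yx => `|(EM_kernel b sigma yx.1 yx.2 (s ^+ 2) * u yx.2)%:E|%E)
    (measurableT_comp (@abse_measurable _ _) mku) (fun=> abse_ge0 _)).
move=> y _; apply: le_trans (le_abse_integral mu measurableT _); last first.
  exact: measurableT_comp mku (measurable_pair1 y).
rewrite /EM_propagator /Rintegral.
by case: integral => [r| |]; rewrite ?abse_EFin ?lexx//= normr0 ?leey.
Qed.

End kernel.

(** * From the pointwise expansion to the L^1 norm *)
Section norm_estimate.
Context {R : realType} (d : nat).
Local Notation mu := (lebesgue_rV R d).

Lemma continuous_fokker_planck (a : 'rV[R]_d -> 'M[R]_d) (b : 'rV[R]_d -> 'rV[R]_d) u :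
  (forall i j, is_Ck 4 (fun x => a x i j)) -> (forall i, is_Ck 4 (fun x => b x ord0 i)) ->
  is_Ck 4 u -> continuous (fokker_planck a b u).
Proof.
move=> Ca Cb Cu; apply: (@is_Ck_continuous _ _ 2).
have C1 : is_Ck 2 (fun x => \sum_(i < d) partial i (fun x => b x ord0 i * u x) x).
  apply: is_Ck_sum => i.
  by apply: is_CkS; exact: ((is_CkM (Cb i) Cu).2 i).2.
have C2 : is_Ck 2 (fun x => \sum_(i < d) \sum_(j < d) partial i (partial j (fun z => a z i j * u z)) x).
  apply: is_Ck_sum => i; apply: is_Ck_sum => j.
  exact: (((is_CkM (Ca i j) Cu).2 j).2.2 i).2.
have := is_CkD (is_CkM (is_Ck_cst d 2 (-1)) C1) (is_CkM (is_Ck_cst d 2 2^-1) C2).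
by congr (is_Ck 2 _); apply/funext => x; rewrite /fokker_planck /= mulN1r.
Qed.

Lemma integral_gauss_fin e : 0 < e ->
  (\int[mu]_y (expR (- e * sqn y))%:E)%E = (\int[mu]_y expR (- e * sqn y))%:E.
Proof.
by move=> e0; rewrite /Rintegral fineK//; exact: integrable_fin_num (integrable_gauss d e0).
Qed.

(** For [s <= 1] integrate the pointwise bound.  For [s > 1] only the uniform bound on the
    norms of [P s] and [u] is used, together with the expansion at [s = 1], which bounds
    the norm of [A]. *)
Lemma le_norm1_of_expansion (P : R -> 'rV[R]_d -> R) (u A : 'rV[R]_d -> R) (C e U : R) :
  0 < C -> 0 < e -> 0 <= U ->
  (forall s, 0 < s -> measurable_fun setT (P s)) ->
  measurable_fun setT u -> measurable_fun setT A ->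
  (forall s y, 0 < s <= 1 ->
    `|P s y - u y - s ^+ 2 * A y| <= C * s ^+ 4 * expR (- e * sqn y)) ->
  (forall s : R, (0 < s)%R -> \int[mu]_y (`|P s y|)%:E <= U%:E)%E ->
  (\int[mu]_y (`|u y|)%:E <= U%:E)%E ->
  exists2 K : R, 0 < K & forall s : R, 0 < s ->
    (\int[mu]_y `|((P s y - u y) / s ^+ 2 - A y)%:E| <= (K * s ^+ 2)%:E)%E.
Proof.
move=> C0 e0 U0 mP mu_ mA PA hP hu.
pose G := \int[mu]_y expR (- e * sqn y).
have G0 : 0 <= G by apply: Rintegral_ge0 => y _; exact: expR_ge0.
have GE : (\int[mu]_y (expR (- e * sqn y))%:E = G%:E)%E by exact: integral_gauss_fin.
have mG : measurable_fun setT (fun y : 'rV[R]_d => expR (- e * sqn y)) by exact: measurable_gauss.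
exists (4 * U + C * G + 1) => [|s s0].
  by rewrite ltr_wpDl// addr_ge0// mulr_ge0// ltW.
pose D y := (P s y - u y) / s ^+ 2 - A y.
have mD : measurable_fun setT (fun y => `|(D y)%:E|%E).
  apply: measurableT_comp => //; apply/measurable_EFinP.
  apply: measurable_funB => //; apply: measurable_funM => //.
  by apply: measurable_funB => //; exact: mP.
rewrite -[leLHS]/(\int[mu]_y `|(D y)%:E|)%E.
have [s1|s1] := leP s 1.
  apply: (@le_trans _ _ (\int[mu]_y ((C * s ^+ 2)%:E * (expR (- e * sqn y))%:E))%E).
    apply: ge0_le_integral => //.
      by apply: measurable_funeM; exact/measurable_EFinP.
    move=> y _; rewrite -EFinM /= lee_fin.
    have s2n : s ^+ 2 != 0 by rewrite expf_neq0// gt_eqF.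
    have -> : D y = (P s y - u y - s ^+ 2 * A y) / s ^+ 2 by rewrite /D [RHS]mulrBl [s ^+ 2 * A y]mulrC mulfK.
    rewrite normrM normfV (ger0_norm (sqr_ge0 s)) ler_pdivrMr ?exprn_gt0//.
    rewrite (le_trans (PA s y _)) ?s0//.
    by rewrite [leRHS](_ : _ = C * s ^+ 4 * expR (- e * sqn y))//; ring.
  rewrite ge0_integralZl//; last 2 first.
  - exact/measurable_EFinP.
  - by rewrite lee_fin mulr_ge0 ?sqr_ge0// ltW.
  rewrite GE -EFinM lee_fin mulrAC ler_wpM2r ?sqr_ge0//.
  by have := mulr_ge0 (ler0n R 4) U0; lra.
have mE (f : 'rV[R]_d -> R) : measurable_fun setT f -> measurable_fun setT (fun y => (`|f y|)%:E).
  by move=> mf; apply/measurable_EFinP; exact: measurableT_comp.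
have m1 := mE _ (mP s s0).
have m2 : measurable_fun setT (fun y => 2%:E * (`|u y|)%:E)%E by apply: measurable_funeM; exact: mE.
have m3 := mE _ (mP 1 ltr01).
have m4 : measurable_fun setT (fun y : 'rV[R]_d => C%:E * (expR (- e * sqn y))%:E)%E.
  by apply: measurable_funeM; exact/measurable_EFinP.
have p4 (y : 'rV[R]_d) : (0 <= C%:E * (expR (- e * sqn y))%:E)%E.
  by rewrite -EFinM lee_fin mulr_ge0 ?expR_ge0// ltW.
apply: (@le_trans _ _ (\int[mu]_y ((`|P s y|)%:E + (2%:E * (`|u y|)%:E + ((`|P 1 y|)%:E + C%:E * (expR (- e * sqn y))%:E))))%E).
  apply: ge0_le_integral => //.
    apply: emeasurable_funD => //; apply: emeasurable_funD => //.
    exact: emeasurable_funD.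
  move=> y _; rewrite -!EFinM -!EFinD /= lee_fin.
  have := PA 1 y; rewrite ltr01 lexx !expr1n mul1r mulr1 => /(_ isT) h1.
  have h2 : `|(P s y - u y) / s ^+ 2| <= `|P s y| + `|u y|.
    have s21 : 1 <= s ^+ 2 by rewrite exprn_ege1// ltW.
    rewrite normrM normfV (ger0_norm (sqr_ge0 s)) ler_pdivrMr ?exprn_gt0//.
    apply: le_trans (ler_normB _ _) _; by rewrite ler_peMr ?addr_ge0.
  have h3 : `|D y| <= `|(P s y - u y) / s ^+ 2| + `|A y| by exact: ler_normB.
  have h4 : `|A y| <= `|P 1 y| + `|u y| + C * expR (- e * sqn y).
    have -> : A y = (P 1 y - u y) - (P 1 y - u y - A y) by ring.
    apply: le_trans (ler_normB _ _) _; rewrite lerD//; exact: ler_normB.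
  lra.
have q1 y : (0 <= (`|P s y|)%:E)%E by [].
have q2 y : (0 <= 2%:E * (`|u y|)%:E)%E by rewrite mule_ge0.
have q3 y : (0 <= (`|P 1 y|)%:E)%E by [].
have q34 y : (0 <= (`|P 1 y|)%:E + C%:E * (expR (- e * sqn y))%:E)%E by rewrite adde_ge0.
have q234 y : (0 <= 2%:E * (`|u y|)%:E +
    ((`|P 1 y|)%:E + C%:E * (expR (- e * sqn y))%:E))%E by rewrite adde_ge0.
have m34 := emeasurable_funD m3 m4.
have m234 := emeasurable_funD m2 m34.
rewrite (ge0_integralD mu measurableT (fun y _ => q1 y) m1 (fun y _ => q234 y) m234).
rewrite (ge0_integralD mu measurableT (fun y _ => q2 y) m2 (fun y _ => q34 y) m34).
rewrite (ge0_integralD mu measurableT (fun y _ => q3 y) m3 (fun y _ => p4 y) m4).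
rewrite !ge0_integralZl//; last 3 first.
- exact/measurable_EFinP.
- by rewrite lee_fin ltW.
- exact: mE.
rewrite GE.
apply: (@le_trans _ _ (U%:E + (2%:E * U%:E + (U%:E + C%:E * G%:E)))%E).
  rewrite leeD ?hP// leeD//; last by rewrite leeD2r// hP.
  by rewrite lee_pmul2l.
rewrite -!EFinM -!EFinD lee_fin.
have s21 : 1 <= s ^+ 2 by rewrite exprn_ege1// ltW.
have CG := mulr_ge0 (ltW C0) G0.
apply: le_trans (_ : (4 * U + C * G + 1) * 1 <= _); first lra.
by rewrite ler_wpM2l//; lra.
Qed.

End norm_estimate.

Theorem proposition2p10 (R : realType) (d q : nat)
  (hd : (1 <= d)%N) (hq : (1 <= q)%N)
  (b : 'rV[R]_d -> 'rV[R]_d) (sigma : 'rV[R]_d -> 'M[R]_(d, q))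
  (b_C4 : forall i : 'I_d, is_Ck 4 (fun x => b x ord0 i))
  (sigma_C4 : forall (i : 'I_d) (j : 'I_q), is_Ck 4 (fun x => sigma x i j))
  (grad_bounded : exists2 K : R, 0 < K &
     forall (x : 'rV[R]_d) (j : 'I_q) (i k : 'I_d),
       `|partial k (fun z => sigma z i j) x| +
       `|partial k (fun z => b z ord0 i) x| <= K)
  (elliptic : exists2 alpha : R, 0 < alpha &
     forall x y : 'rV[R]_d,
       (y *m diffusion sigma x *m y^T) ord0 ord0 >=
         alpha * (y *m y^T) ord0 ord0)
  (u : 'rV[R]_d -> R) (u_Ccinfty : is_Ccinfty u) :
  exists2 C : R, 0 < C & forall tau : R, 0 < tau ->
    ('N[lebesgue_rV R d]_1
       [(fun y => ((EM_propagator b sigma tau u y - u y) / tau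
                  - FP_operator b sigma u y)%:E)] <= (C * tau)%:E)%E.
Proof.
have [alpha alpha0 ell] := elliptic.
have [Ck_u /compact_support_bounded[rho u0]] := u_Ccinfty.
have Cu := Ck_u 4; clear Ck_u.
pose p := precision sigma.
have pb : precision_field p b := precision_field_diffusion b_C4 sigma_C4 alpha0 ell.
pose c x := u x / gmass p x.
have Cc : is_Ck 4 c := div_gmass_C4 sigma_C4 alpha0 ell Cu.
have cu x : c x * gmass p x = u x.
  by rewrite /c divfK// gt_eqF// (gmass_precision_gt0 alpha0 ell).
have ap x : diffusion sigma x *m p x = 1%:M.
  by rewrite mulmxV// (diffusion_unit alpha0 ell).
have c0 x : rho < `|x| -> c x = 0 by move=> /u0; rewrite /c => ->; rewrite mul0r.
have Ca := diffusion_C4 sigma_C4.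
have [C C0 [e e0 dens]] := density_expansion pb ap Ca Cc Cu cu c0.
pose P s y := EM_propagator b sigma (s ^+ 2) u y.
pose A := fokker_planck (diffusion sigma) b u.
have PA s y : 0 < s <= 1 -> `|P s y - u y - s ^+ 2 * A y| <= C * s ^+ 4 * expR (- e * sqn y).
  move=> /andP[s0 s1]; rewrite /P (EM_propagator_density b_C4 sigma_C4 alpha0 ell Cu)//.
  by apply: dens; rewrite ltW.
have mP s : 0 < s -> measurable_fun setT (P s).
  move=> s0; exact: (measurable_EM_propagator b_C4 sigma_C4 alpha0 ell Cu u0 s0).
have mu_ : measurable_fun setT u := continuous_measurable_rV (is_Ck_continuous Cu).
have mA : measurable_fun setT A.
  exact: continuous_measurable_rV (continuous_fokker_planck Ca b_C4 Cu).
have iu := integrable_compact_support Cu u0.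
have ufin : (\int[lebesgue_rV R d]_x `|(u x)%:E| \is a fin_num)%E.
  by rewrite ge0_fin_numE ?integral_ge0//; case/integrableP : iu.
pose U := fine (\int[lebesgue_rV R d]_x `|(u x)%:E|)%E.
have U0 : 0 <= U by rewrite fine_ge0// integral_ge0.
have hP s : 0 < s -> (\int[lebesgue_rV R d]_y (`|P s y|)%:E <= U%:E)%E.
  move=> s0; rewrite /U fineK//.
  exact: (le_norm1_EM_propagator b_C4 sigma_C4 alpha0 ell Cu u0 s0).
have hu : (\int[lebesgue_rV R d]_y (`|u y|)%:E <= U%:E)%E by rewrite /U fineK.
have [K K0 HK] := le_norm1_of_expansion C0 e0 U0 mP mu_ mA PA hP hu.
exists K => // tau tau0.
have s0 : 0 < Num.sqrt tau by rewrite sqrtr_gt0.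
have := HK _ s0; rewrite /P sqr_sqrtr ?(ltW tau0)// Lnorm1; exact.
Qed.
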